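(* Let $P$ be the marginal Metropolis--Hastings kernel with target $\pi$ and proposal $q$, and for each $N\in\mathbb N$ let $\tilde P_N$ be the pseudo-marginal kernel, with invariant distribution $\tilde\pi_N$, built from weight distributions $\{Q_x^N\}_{x\in\mathsf X}$. Let $g:\mathsf X\to\mathbb R$ satisfy $\pi(|g|^{2+\delta})<\infty$ for some $\delta>0$. Suppose that: (1) the integrated autocorrelation time $\tau(g,P)$ is well defined and finite, and there exists a constant $N_0<\infty$ such that $$\lim_{n\to\infty}\sup_{N\ge N_0}\Bigl|\sum_{k=n}^\infty\mathbb E[\bar g(\tilde X_0^N)\bar g(\tilde X_k^N)]\Bigr|=0,\qquad \bar g=g-\pi(g),$$ where $(\tilde X_k^N,\tilde W_k^N)_{k\ge0}$ is the Markov chain with initial distribution $\tilde\pi_N$ and kernel $\tilde P_N$; (2) $\displaystyle\lim_{N\to\infty}\int Q_x^N(\mathrm dw)|1-w|=0$ for all $x\in\mathsf X$. Then $\lim_{N\to\infty}\operatorname{var}(g,\tilde P_N)=\operatorname{var}(g,P)$.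
   Context: Let $(\mathsf X,\mathcal B(\mathsf X))$ be a measurable space, $\pi$ a probability measure on it and $q(x,\mathrm dy)$ a Markov kernel on $\mathsf X$. The function $r(x,y)=\frac{\pi(\mathrm dy)q(y,\mathrm dx)}{\pi(\mathrm dx)q(x,\mathrm dy)}$ is the Radon--Nikodym derivative in the sense of Tierney: there is a symmetric measurable set $R\subset\mathsf X^2$ on which the measures $\pi(\mathrm dx)q(x,\mathrm dy)$ and $\pi(\mathrm dy)q(y,\mathrm dx)$ are mutually absolutely continuous, and on whose complement they are mutually singular; on $R$, $r$ is the density of the second with respect to the first, with values in $(0,\infty)$ and $r(x,y)r(y,x)=1$; off $R$, $r:=0$. The marginal kernel is $P(x,\mathrm dy)=\min\{1,r(x,y)\}q(x,\mathrm dy)+\delta_x(\mathrm dy)\rho(x)$ with $\rho(x)=1-\int\min\{1,r(x,y)\}q(x,\mathrm dy)$. Let $\mathsf W$ be a Borel subset of $\mathbb R_+=[0,\infty)$. For each $N\in\mathbb N$, $x\mapsto Q_x^N$ is a probability kernel from $\mathsf X$ to $\mathsf W$ with $\int w\,Q_x^N(\mathrm dw)=1$ for all $x$. Put $\pi_x^N(\mathrm dw)=w\,Q_x^N(\mathrm dw)$ and $\tilde\pi_N(\mathrm dx,\mathrm dw)=\pi(\mathrm dx)\pi_x^N(\mathrm dw)$. The pseudo-marginal kernel is $\tilde P_N(x,w;\mathrm dy,\mathrm du)=\min\{1,r(x,y)\frac uw\}q(x,\mathrm dy)Q_y^N(\mathrm du)+\delta_{x,w}(\mathrm dy,\mathrm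 du)\tilde\rho_N(x,w)$ with $\tilde\rho_N(x,w)=1-\iint\min\{1,r(x,y)\frac uw\}q(x,\mathrm dy)Q_y^N(\mathrm du)$; it is reversible with respect to $\tilde\pi_N$. (If $0\in\mathsf W$, read $\min\{1,r(x,y)u/w\}$ as $1$ for $w=0$; the set $\{w=0\}$ is $\tilde\pi_N$-null.) For a Markov kernel $\Pi$ reversible with respect to a probability $\mu$, the stationary chain $(X_k)_{k\ge0}$ with kernel $\Pi$ and $X_0\sim\mu$, and $f$ with $\mu(f^2)<\infty$: $\operatorname{var}(f,\Pi):=\lim_{n\to\infty}\frac1n\mathbb E\bigl(\sum_{k=1}^n (f(X_k)-\mu(f))\bigr)^2\in[0,\infty]$ (the limit always exists) and $\tau(f,\Pi):=1+2\sum_{k=1}^\infty\frac{\mathbb E[f(X_0)f(X_k)]-\mu(f)^2}{\operatorname{var}_\mu(f)}$ with $\operatorname{var}_\mu(f)=\mu((f-\mu(f))^2)$. A function $g$ on $\mathsf X$ is identified with $(x,w)\mapsto g(x)$, so $\operatorname{var}(g,\tilde P_N)$ is the asymptotic variance of the latter. *)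

(* Defs.v *)
From HB Require Import structures.
From mathcomp Require Export all_boot all_order all_algebra.
From mathcomp Require Export all_classical all_reals all_analysis.

Set Implicit Arguments.
Unset Strict Implicit.
Unset Printing Implicit Defensive.

Import Order.TTheory GRing.Theory Num.Theory.
Import numFieldNormedType.Exports.

Local Open Scope classical_set_scope.
Local Open Scope ring_scope.
Local Open Scope ereal_scope.

Definition past d d' (O : measurableType d) (E : measurableType d')
    (X : nat -> O -> E) (n : nat) : set (set O) :=
  <<s [set A | exists k B, [/\ (k <= n)%N, measurable B & A = X k @^-1` B] ] >>.

(* The second clause says that K (X n) B is a version of the conditional
   probability of X n.+1 \in B given the past up to time n. *)
Definition markov_chain d d' (O : measurableType d) (E : measurableType d')
    (R : realType) (mu : probability E R) (K : R.-pker E ~> E)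
    (Pr : probability O R) (X : nat -> {mfun O >-> E}) : Prop :=
  (forall B, measurable B -> Pr (X 0%N @^-1` B) = mu B) /\
  (forall n A B, past X n A -> measurable B ->
     Pr (A `&` X n.+1 @^-1` B) = \int[Pr]_(w in A) K (X n w) B).

(* In the following definitions, X is meant to be a chain under Pr started from
   its stationary distribution mu; the values depend only on its law. *)

Definition asymptotic_variance d d' (O : measurableType d)
    (E : measurableType d') (R : realType) (mu : probability E R)
    (Pr : probability O R) (X : nat -> O -> E) (f : E -> R) : \bar R :=
  limn (fun n : nat => (n%:R^-1)%:E *
    'E_Pr[(fun w => (\sum_(1 <= k < n.+1) (f (X k w) - fine 'E_mu[f])) ^+ 2)%R]).

Definition iact_partial d d' (O : measurableType d)
    (E : measurableType d') (R : realType) (mu : probability E R)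
    (Pr : probability O R) (X : nat -> O -> E) (f : E -> R) (n : nat) : \bar R :=
  1 + 2%:E * \sum_(1 <= k < n.+1)
    ('E_Pr[(fun w => f (X 0%N w) * f (X k w))%R] - (fine 'E_mu[f] ^+ 2)%:E)
      * ((fine 'V_mu[f])^-1)%:E.

Definition iact d d' (O : measurableType d)
    (E : measurableType d') (R : realType) (mu : probability E R)
    (Pr : probability O R) (X : nat -> O -> E) (f : E -> R) : \bar R :=
  limn (iact_partial mu Pr X f).

(* A degenerate f, with 'V_mu[f] = 0, gives iact = 1 since 0^-1 = 0. *)
Definition iact_well_defined d d' (O : measurableType d)
    (E : measurableType d') (R : realType) (mu : probability E R)
    (Pr : probability O R) (X : nat -> O -> E) (f : E -> R) : Prop :=
  cvgn (iact_partial mu Pr X f).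

(* flow is pi(dx)q(x,dy) and flow_rev is pi(dy)q(y,dx). *)
Definition flow d (X : measurableType d) (R : realType)
    (pi : probability X R) (q : R.-pker X ~> X) (A : set (X * X)) : \bar R :=
  \int[pi]_x q x (xsection A x).

Definition flow_rev d (X : measurableType d) (R : realType)
    (pi : probability X R) (q : R.-pker X ~> X) (A : set (X * X)) : \bar R :=
  flow pi q [set z | A (z.2, z.1)].

(* Tierney's version of the derivative of flow_rev with respect to flow: the two
   are equivalent on S, mutually singular off S, and r = 0 off S. *)
Definition mh_ratio d (X : measurableType d) (R : realType)
    (pi : probability X R) (q : R.-pker X ~> X) (r : X * X -> R) : Prop :=
  measurable_fun setT r /\
  exists S : set (X * X),
    [/\ measurable S /\ (forall x y, S (x, y) -> S (y, x)),
        (forall A, measurable A -> A `<=` S ->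
           flow pi q A = 0 <-> flow_rev pi q A = 0),
        (exists B, [/\ measurable B, B `<=` ~` S,
           flow pi q B = 0 & flow_rev pi q (~` S `\` B) = 0]),
        (forall A, measurable A -> A `<=` S ->
           flow_rev pi q A =
             \int[pi]_x \int[q x]_(y in xsection A x) (r (x, y))%:E)
      & (forall x y, S (x, y) -> (0 < r (x, y) /\ r (x, y) * r (y, x) = 1)%R) /\
        (forall x y, ~ S (x, y) -> r (x, y) = 0%R) ].

Definition marginal_acc d (X : measurableType d) (R : realType)
    (r : X * X -> R) (x y : X) : R := Num.min 1%R (r (x, y)).

Definition is_marginal_kernel d (X : measurableType d) (R : realType)
    (q : R.-pker X ~> X) (r : X * X -> R) (P : R.-pker X ~> X) : Prop :=
  forall x A, measurable A ->
    P x A = \int[q x]_(y in A) (marginal_acc r x y)%:E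
            + \d_x A * (1 - \int[q x]_y (marginal_acc r x y)%:E).

(* Weights are carried by R: a kernel to a Borel set W of nonnegative weights is
   encoded as a kernel Q to R with Q x W = 1 for all x.  The pseudo-marginal
   chain then lives on X * R but stays almost surely in X * W, and the values
   given below to negative weights are immaterial. *)
Definition weight_kernel d (X : measurableType d) (R : realType)
    (W : set R) (Q : R.-pker X ~> R) : Prop :=
  (forall x, Q x W = 1) /\ (forall x, \int[Q x]_w w%:E = 1).

Definition is_pseudo_target d (X : measurableType d) (R : realType)
    (pi : probability X R) (Q : R.-pker X ~> R)
    (pit : probability (X * R)%type R) : Prop :=
  forall A, measurable A ->
    pit A = \int[pi]_x \int[Q x]_(w in xsection A x) w%:E.

(* min(1, r(x,y) u/w), read as 1 when w = 0. *)
Definition pseudo_acc d (X : measurableType d) (R : realType)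
    (r : X * X -> R) (x : X) (w : R) (y : X) (u : R) : R :=
  if (0 < w)%R then Num.min 1%R (r (x, y) * (u / w))%R else 1%R.

Definition is_pseudo_kernel d (X : measurableType d) (R : realType)
    (q : R.-pker X ~> X) (r : X * X -> R) (Q : R.-pker X ~> R)
    (Pt : R.-pker (X * R)%type ~> (X * R)%type) : Prop :=
  forall x w A, measurable A ->
    Pt (x, w) A =
      \int[q x]_y \int[Q y]_(u in xsection A y) (pseudo_acc r x w y u)%:E
      + \d_(x, w) A *
        (1 - \int[q x]_y \int[Q y]_u (pseudo_acc r x w y u)%:E).

(* Main.v *)
From HB Require Import structures.
Require Import Defs.
From mathcomp Require Import all_boot all_order all_algebra.
From mathcomp Require Import all_classical all_reals all_analysis.
From mathcomp Require Import measurable_realfun.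
From mathcomp Require Import ring lra.
Set Implicit Arguments.
Unset Strict Implicit.
Unset Printing Implicit Defensive.
Import Order.TTheory GRing.Theory Num.Theory.
Import numFieldNormedType.Exports.
Local Open Scope classical_set_scope.
Local Open Scope ring_scope.
Local Open Scope ereal_scope.

(** Write gbar = g - pi(g) and, for a stationary chain X, c_k for the covariance
    E[gbar(X_0) gbar(X_k)].  By stationarity the normalised second moment of a
    sum of n terms is the Cesaro mean of the partial sums
    s_m = c_0 + 2 (c_1 + ... + c_m) (integral_square_sum), so the asymptotic
    variance is lim s_m as soon as this limit exists.  For the marginal chain it
    exists because the autocorrelation time is finite (cov_sum_cvg_iact); for
    the pseudo-marginal chains it exists because the tails of the covariance
    series converge (cov_sum_tail).  As these tails are small uniformly in N, the
    limits in n and N may be exchanged (cvg_uniform_exchange), and what is left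
    is the convergence of each single covariance: c_k for the N-th
    pseudo-marginal chain tends to c_k for the marginal chain
    (pseudo_cov_cvg).

    That convergence comes from an L1 estimate.  For a function h of the first
    coordinate with 0 <= h <= C, the difference between one step of the
    pseudo-marginal kernel from (x, w) and one step of the marginal kernel from
    x is at most 2 C times the expected difference of the acceptance
    probabilities (pseudo_marginal_perturb).  Integrated against the
    pseudo-marginal target, which has density w, this difference involves
    |min(w, r u) - w min(1, r)| <= 2 |1 - w| + r |1 - u|.  The last term is
    controlled by the reversal of the proposal flow (mh_ratio_swap): with the
    weight r(x, y), the average of a nonnegative function of y over
    pi(dx) q(x, dy) is at most the average of the same function of x.  Hence
    the whole is at most three times
    kappa_N = \int pi(dx) \int Q_x^N(dw) |1 - w| (acc_error_integral), which tends
    to 0 by dominated convergence (weight_error_cvg).  Since the chains are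
    stationary, replacing the pseudo-marginal kernel by the marginal one step
    after step accumulates an error of order k kappa_N in the k-th covariance of a
    bounded function (chain_comparison, cov_comparison).  A square integrable
    gbar is reduced to a bounded function by truncation, whose effect on c_k is
    bounded independently of the chain by a Young inequality and stationarity
    (cov_approx).

    Stationarity of both chains is derived from the definition of r
    (marginal_invariant, pseudo_invariant).  The kernels are only described by
    their values on sets; integrals of functions are obtained from these by a
    monotone class argument, packaged once and for all in
    positive_functional_eq. *)

(** * Nonnegative measurable functions and positive functionals *)

Definition nnmeas d (T : measurableType d) (R : realType) (f : T -> \bar R) :=
  (forall x, 0 <= f x) /\ measurable_fun setT f.

Section nnmeas.
Context d (T : measurableType d) (R : realType).
Implicit Types f g : T -> \bar R.

Lemma nnmeas_ge0 f x : nnmeas f -> 0 <= f x. Proof. by case. Qed.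

Lemma nnmeas_measurable f : nnmeas f -> measurable_fun setT f.
Proof. by case. Qed.

Lemma nnmeas_cst (c : \bar R) : 0 <= c -> nnmeas (fun _ : T => c).
Proof. by move=> c0; split=> //; exact: measurable_cst. Qed.

Lemma nnmeasD f g : nnmeas f -> nnmeas g -> nnmeas (fun x => f x + g x).
Proof.
move=> [f0 mf] [g0 mg]; split=> [x|]; first exact: adde_ge0.
exact: emeasurable_funD.
Qed.

Lemma nnmeasM f g : nnmeas f -> nnmeas g -> nnmeas (fun x => f x * g x).
Proof.
move=> [f0 mf] [g0 mg]; split=> [x|]; first exact: mule_ge0.
exact: emeasurable_funM.
Qed.

Lemma nnmeas_EFin (f : T -> R) : (forall x, (0 <= f x)%R) ->
  measurable_fun setT f -> nnmeas (fun x => (f x)%:E).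
Proof.
by move=> f0 mf; split=> [x|]; [rewrite lee_fin|exact/measurable_EFinP].
Qed.

Lemma nnmeas_indic (A : set T) : measurable A ->
  nnmeas (fun x => (\1_A x : R)%:E).
Proof.
by move=> mA; apply: nnmeas_EFin => [x|]; rewrite ?indicE ?ler0n.
Qed.

End nnmeas.

Lemma nnmeas_comp d d' (T : measurableType d) (T' : measurableType d')
    (R : realType) (f : T' -> \bar R) (phi : T -> T') :
  measurable_fun setT phi -> nnmeas f -> nnmeas (fun x => f (phi x)).
Proof. by move=> mphi [f0 mf]; split=> //; exact: measurableT_comp. Qed.

Lemma nnmeas_kernel d d' (T : measurableType d) (T' : measurableType d')
    (R : realType) (k : R.-pker T ~> T') (f : T * T' -> \bar R) :
  nnmeas f -> nnmeas (fun x => \int[k x]_y f (x, y)).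
Proof.
move=> [f0 mf]; split=> [x|]; first by apply: integral_ge0 => y _.
exact: measurable_fun_integral_finite_kernel.
Qed.

Section positive_functional.
Context d (T : measurableType d) (R : realType).
Implicit Types (L : (T -> \bar R) -> \bar R).

(** The properties of an integral that are stable under the constructions below:
    reweighting, change of variable, sums, iteration along a kernel.  Any
    expression built in this way is determined by its values on indicators, so
    that an identity between two such expressions, like the description of a
    kernel on sets, extends to functions without a new approximation argument. *)
Record positive_functional L : Prop := PositiveFunctional {
  pf_ge0 : forall f, nnmeas f -> 0 <= L f ;
  pf_le : forall f g, nnmeas f -> nnmeas g ->
    (forall x, f x <= g x) -> L f <= L g ;
  pf_add : forall f g, nnmeas f -> nnmeas g ->
    L (fun x => f x + g x) = L f + L g ;
  pf_scale : forall (c : R) f, (0 <= c)%R -> nnmeas f ->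
    L (fun x => c%:E * f x) = c%:E * L f ;
  pf_lim : forall f : nat -> T -> \bar R, (forall n, nnmeas (f n)) ->
    (forall x, nondecreasing_seq (f^~ x)) ->
    L (fun x => limn (f^~ x)) = limn (fun n => L (f n)) }.

Import HBNNSimple.

Lemma pf_sum L (I : choiceType) (s : seq I) (c : I -> R) (A : I -> set T) :
  positive_functional L -> (forall i, (0 <= c i)%R) ->
  (forall i, measurable (A i)) ->
  L (fun x => (\sum_(i <- s) c i * \1_(A i) x)%:E) =
  \sum_(i <- s) (c i)%:E * L (fun x => (\1_(A i) x)%:E).
Proof.
move=> pL c0 mA; elim: s => [|i s ih].
  rewrite big_nil.
  transitivity (L (fun x => 0%:E * (fun=> 0) x)).
    by congr L; apply/funext => x; rewrite big_nil mul0e.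
  by rewrite (pf_scale pL)// ?mul0e//; exact: nnmeas_cst.
rewrite big_cons -ih -(pf_scale pL) ?c0//; last exact: nnmeas_indic.
rewrite -(pf_add pL).
- by congr L; apply/funext => x; rewrite big_cons EFinD EFinM.
- apply: nnmeasM; last exact: nnmeas_indic.
  by apply: nnmeas_cst; rewrite lee_fin.
- apply: nnmeas_EFin => [x|].
    by apply: sumr_ge0 => j _; rewrite mulr_ge0// indicE ler0n.
  by apply: measurable_sum => j; exact: measurable_funM.
Qed.

(** Both sides are determined by simple functions through increasing limits. *)
Lemma positive_functional_eq L1 L2 :
  positive_functional L1 -> positive_functional L2 ->
  (forall A, measurable A ->
    L1 (fun x => (\1_A x)%:E) = L2 (fun x => (\1_A x)%:E)) ->
  forall f, nnmeas f -> L1 f = L2 f.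
Proof.
move=> p1 p2 L12 f [f0 mf].
pose f_ := nnsfun_approx measurableT mf.
have fE : f = fun x => limn (fun n => (f_ n x)%:E).
  by apply/funext => x; apply/esym/cvg_lim => //; exact: cvg_nnsfun_approx.
have nnf n : nnmeas (fun x => (f_ n x)%:E) by exact: nnmeas_EFin.
have ndf x : nondecreasing_seq (fun n => (f_ n x)%:E).
  by move=> a b ab; rewrite lee_fin; exact/lefP/nd_nnsfun_approx.
rewrite fE (pf_lim p1)// (pf_lim p2)//; congr (limn _); apply/funext => n.
(* Negative values have empty preimages: clipping them makes every coefficient
   nonnegative without changing the sum. *)
have fnE : (fun x => (f_ n x)%:E) = (fun x =>
    (\sum_(r <- finmap.enum_fset (fset_set (range (f_ n))))
      (Num.max 0 r) * \1_(f_ n @^-1` [set r]) x)%:E).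
  apply/funext => x; congr EFin; rewrite fimfunE fsbig_finite//=.
  apply: eq_bigr => r _; have [r0|r0] := leP 0%R r; first by [].
  by rewrite preimage_nnfun0// indic0 !mulr0.
rewrite fnE (pf_sum _ p1)// ?(pf_sum _ p2)//.
- by apply: eq_bigr => r _; rewrite L12.
- by move=> r; rewrite le_max lexx.
- by move=> r; rewrite le_max lexx.
Qed.

Lemma pf_integral (mu : {measure set T -> \bar R}) :
  positive_functional (fun f => \int[mu]_x f x).
Proof.
split.
- by move=> f [f0 _]; apply: integral_ge0 => x _.
- by move=> f g [f0 mf] [g0 mg] fg; apply: ge0_le_integral => // x _.
- by move=> f g [f0 mf] [g0 mg]; rewrite ge0_integralD.
- by move=> c f c0 [f0 mf]; rewrite ge0_integralZl.
- move=> f nnf ndf; rewrite monotone_convergence//.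
  + by move=> n; case: (nnf n).
  + by move=> n x _; case: (nnf n).
Qed.

Lemma pf_at (x : T) : positive_functional (fun f => f x).
Proof.
split=> //.
- by move=> f [].
Qed.

Lemma pf_plus L1 L2 : positive_functional L1 -> positive_functional L2 ->
  positive_functional (fun f => L1 f + L2 f).
Proof.
move=> p1 p2; split.
- by move=> f nf; rewrite adde_ge0// ?(pf_ge0 p1) ?(pf_ge0 p2).
- by move=> f g nf ng fg; rewrite leeD// ?(pf_le p1) ?(pf_le p2).
- by move=> f g nf ng; rewrite (pf_add p1)// (pf_add p2)// addeACA.
- move=> c f c0 nf; rewrite (pf_scale p1)// (pf_scale p2)//.
  by rewrite ge0_muleDr// ?(pf_ge0 p1) ?(pf_ge0 p2).
- move=> f nnf ndf.
  have cvgL L : positive_functional L -> cvgn (fun n => L (f n)).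
    move=> pL; apply: ereal_nondecreasing_is_cvgn => m n mn.
    by apply: (pf_le pL) => // x; exact: ndf.
  have limL L : positive_functional L -> 0 <= limn (fun n => L (f n)).
    move=> pL; apply: lime_ge; first exact: cvgL.
    by apply: nearW => n; exact: (pf_ge0 pL).
  rewrite (pf_lim p1)// (pf_lim p2)// -limeD//; [exact: cvgL|exact: cvgL|].
  by apply: ge0_adde_def; rewrite inE; exact: limL.
Qed.

End positive_functional.

Lemma pf_mulcomp d d' (T : measurableType d) (T' : measurableType d')
    (R : realType) (L : (T -> \bar R) -> \bar R) (w : T -> R) (phi : T -> T') :
  positive_functional L -> (forall x, (0 <= w x)%R) -> measurable_fun setT w ->
  measurable_fun setT phi ->
  positive_functional (fun f => L (fun x => (w x)%:E * f (phi x))).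
Proof.
move=> pL w0 mw mphi.
have nw : nnmeas (fun x => (w x)%:E) by exact: nnmeas_EFin.
have nn f : nnmeas f -> nnmeas (fun x => (w x)%:E * f (phi x)).
  by move=> nf; apply: nnmeasM => //; exact: nnmeas_comp nf.
split.
- by move=> f nf; exact/(pf_ge0 pL)/nn.
- move=> f g nf ng fg; apply: (pf_le pL); [exact: nn|exact: nn|move=> x].
  by apply: lee_wpmul2l; rewrite ?lee_fin.
- move=> f g nf ng; rewrite -(pf_add pL); [|exact: nn|exact: nn].
  congr L; apply/funext => x.
  by rewrite ge0_muleDr//; [case: nf|case: ng].
- move=> c f c0 nf; rewrite -(pf_scale pL)//; last exact: nn.
  by congr L; apply/funext => x; rewrite muleCA.
- move=> f nnf ndf; rewrite -(pf_lim pL).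
  + congr L; apply/funext => x; rewrite limeMl//.
    exact: ereal_nondecreasing_is_cvgn.
  + by move=> n; exact: nn.
  + by move=> x a b ab; apply: lee_wpmul2l; rewrite ?lee_fin//; exact: ndf.
Qed.

(** Iterated integrals are positive functionals of the joint function; together
    with pf_mulcomp this covers densities with respect to a product. *)
Lemma pf_kernel d d' (T : measurableType d) (T' : measurableType d')
    (R : realType) (L : (T -> \bar R) -> \bar R) (k : R.-pker T ~> T') :
  positive_functional L ->
  positive_functional
    (fun f : T * T' -> \bar R => L (fun x => \int[k x]_y f (x, y))).
Proof.
move=> pL.
have nn f : nnmeas f -> nnmeas (fun x => \int[k x]_y f (x, y)).
  exact: nnmeas_kernel.
have nx (f : T * T' -> \bar R) x : nnmeas f -> nnmeas (fun y => f (x, y)).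
  by apply: nnmeas_comp; exact: pair1_measurable.
split.
- by move=> f nf; exact/(pf_ge0 pL)/nn.
- move=> f g nf ng fg; apply: (pf_le pL); [exact: nn|exact: nn|move=> x].
  by apply: (pf_le (pf_integral (k x))); [exact: nx|exact: nx|].
- move=> f g nf ng; rewrite -(pf_add pL); [|exact: nn|exact: nn].
  congr L; apply/funext => x.
  by rewrite (pf_add (pf_integral (k x)))//; exact: nx.
- move=> c f c0 nf; rewrite -(pf_scale pL)//; last exact: nn.
  congr L; apply/funext => x.
  by rewrite (pf_scale (pf_integral (k x)))//; exact: nx.
- move=> f nnf ndf; rewrite -(pf_lim pL).
  + congr L; apply/funext => x.
    by rewrite (pf_lim (pf_integral (k x))) => // n; exact: nx.
  + by move=> n; exact: nn.
  + move=> x a b ab; apply: (pf_le (pf_integral (k x))); [exact: nx|exact: nx|].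
    by move=> y; exact: ndf.
Qed.

Lemma nnmeas_pair1 d d' (T : measurableType d) (T' : measurableType d')
    (R : realType) (f : T * T' -> \bar R) x :
  nnmeas f -> nnmeas (fun y => f (x, y)).
Proof. exact/nnmeas_comp/pair1_measurable. Qed.

Lemma le_nnmeas_integral d (T : measurableType d) (R : realType)
    (mu : {measure set T -> \bar R}) (f g : T -> \bar R) :
  nnmeas f -> nnmeas g -> (forall x, f x <= g x) ->
  \int[mu]_x f x <= \int[mu]_x g x.
Proof. exact: (pf_le (pf_integral mu)). Qed.

Lemma nnmeas_integralD d (T : measurableType d) (R : realType)
    (mu : {measure set T -> \bar R}) (f g : T -> \bar R) :
  nnmeas f -> nnmeas g ->
  \int[mu]_x (f x + g x) = \int[mu]_x f x + \int[mu]_x g x.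
Proof. exact: (pf_add (pf_integral mu)). Qed.

Lemma nnmeas_integralZ d (T : measurableType d) (R : realType)
    (mu : {measure set T -> \bar R}) (c : \bar R) (f : T -> \bar R) :
  0 <= c -> nnmeas f -> \int[mu]_x (c * f x) = c * \int[mu]_x f x.
Proof. by move=> c0 [f0 mf]; rewrite ge0_integralZl. Qed.

Lemma integral_prob_le d (T : measurableType d) (R : realType)
    (mu : probability T R) (f : T -> \bar R) (C : R) :
  nnmeas f -> (forall x, f x <= C%:E) -> \int[mu]_x f x <= C%:E.
Proof.
move=> nf fC; have C0 : (0 <= C)%R.
  by rewrite -lee_fin (le_trans _ (fC point))//; case: nf.
have nC : nnmeas (fun _ : T => C%:E) by apply: nnmeas_cst; rewrite lee_fin.
apply: (le_trans (le_nnmeas_integral mu nf nC fC)).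
by rewrite integral_cst//= probability_setT mule1.
Qed.

Lemma integral_pker_le d d' (T : measurableType d) (T' : measurableType d')
   (R : realType) (k : R.-pker T ~> T') x (f : T' -> \bar R) (C : R) :
  nnmeas f -> (forall x, f x <= C%:E) -> \int[k x]_y f y <= C%:E.
Proof.
move=> nf fC; have C0 : (0 <= C)%R.
  by rewrite -lee_fin (le_trans _ (fC point))//; case: nf.
have nC : nnmeas (fun _ : T' => C%:E) by apply: nnmeas_cst; rewrite lee_fin.
apply: (le_trans (le_nnmeas_integral (k x) nf nC fC)).
by rewrite integral_cst//= prob_kernel mule1.
Qed.

Lemma integral_pker_cst d d' (T : measurableType d) (T' : measurableType d')
   (R : realType) (k : R.-pker T ~> T') x (c : \bar R) :
  \int[k x]_y c = c.
Proof. by rewrite integral_cst//= prob_kernel mule1. Qed.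

Section mixture.
Context d (T : measurableType d) (R : realType).

(** Both Metropolis-Hastings kernels have this shape: an accepted part L and an
    atom at the current point z with the rejection probability c. *)
Lemma mixture_integral (nu : {measure set T -> \bar R}) L (c : R) (z : T) :
  positive_functional L -> (0 <= c)%R ->
  (forall A, measurable A -> nu A = L (fun x => (\1_A x)%:E) + \d_z A * c%:E) ->
  forall h, nnmeas h -> \int[nu]_x h x = L h + h z * c%:E.
Proof.
move=> pL c0 nuE h nh.
have pc : positive_functional (fun f : T -> \bar R => c%:E * f z).
  exact: (@pf_mulcomp _ _ _ _ _ (fun f => f z) (cst c) id (pf_at R z)).
rewrite [_ * c%:E]muleC.
apply: (positive_functional_eq (pf_integral nu) (pf_plus pL pc)) => // A mA.
by rewrite integral_indic// setIT nuE// muleC diracE indicE.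
Qed.

End mixture.

Section indicator.
Context d (T : measurableType d) (R : realType).
Variable mu : {measure set T -> \bar R}.

Lemma integral_inE (A : set T) (f : T -> \bar R) :
  \int[mu]_(x in A) f x = \int[mu]_x (f x * (\1_A x)%:E).
Proof. by rewrite integral_mkcond epatch_indic. Qed.

End indicator.

(** * Integrals against the marginal and the pseudo-marginal kernels *)

Section weights.
Context d (X : measurableType d) (R : realType).
Variables (W : set R) (Q : R.-pker X ~> R).
Hypotheses (mW : measurable W) (W_ge0 : forall w, W w -> (0 <= w)%R).
Hypothesis hQ : weight_kernel W Q.

(** The weight distributions do not see negative numbers.  This is what allows
    weights to be clipped at 0 everywhere, which keeps all integrands
    nonnegative. *)
Lemma weight_integral_ext x (f g : R -> \bar R) : measurable_fun setT f ->
  measurable_fun setT g -> (forall w, (0 <= w)%R -> f w = g w) ->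
  \int[Q x]_w f w = \int[Q x]_w g w.
Proof.
move=> mf mg fg; apply: ae_eq_integral => //.
exists (~` W); split; first exact: measurableC.
- have QT : Q x [set: R] = 1 by exact: prob_kernel.
  rewrite -setTD measureD//; last by rewrite /= QT ltry.
  by rewrite setTI [X in X - _]QT [X in _ - X](hQ.1 x) subee.
- by move=> w /= nfg Ww; apply: nfg => _; apply: fg; exact: W_ge0.
Qed.

End weights.

Section kernels.
Context d (X : measurableType d) (R : realType).
Variables (pi : probability X R) (q : R.-pker X ~> X) (r : X * X -> R).
Hypotheses (mr : measurable_fun setT r) (r0 : forall z, (0 <= r z)%R).

Lemma marginal_acc_ge0 x y : (0 <= marginal_acc r x y)%R.
Proof. by rewrite /marginal_acc le_min ler01 r0. Qed.

Lemma marginal_acc_le1 x y : (marginal_acc r x y <= 1)%R.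
Proof. by rewrite /marginal_acc ge_min lexx. Qed.

Lemma nnmeas_marginal_acc :
  nnmeas (fun z : X * X => (marginal_acc r z.1 z.2)%:E).
Proof.
apply: nnmeas_EFin => [z|]; first exact: marginal_acc_ge0.
rewrite (_ : (fun _ => _) = (fun z => Num.min 1 (r z))%R).
  exact: measurable_minr.
by apply/funext => -[].
Qed.

Lemma marginal_kernel_integral (P : R.-pker X ~> X) x (h : X -> \bar R) :
  is_marginal_kernel q r P -> nnmeas h ->
  \int[P x]_y h y = \int[q x]_y ((marginal_acc r x y)%:E * h y)
    + h x * (1 - \int[q x]_y (marginal_acc r x y)%:E).
Proof.
move=> hP nh.
have na : nnmeas (fun y => (marginal_acc r x y)%:E).
  exact: (nnmeas_pair1 x nnmeas_marginal_acc).
have ma : measurable_fun setT (marginal_acc r x) by case: na => _ /measurable_EFinP.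
have I0 : 0 <= \int[q x]_y (marginal_acc r x y)%:E.
  by apply: integral_ge0 => y _; case: na.
have I1 : \int[q x]_y (marginal_acc r x y)%:E <= 1.
  by apply: integral_pker_le => // y; rewrite lee_fin marginal_acc_le1.
have [c [c0 cE]] : exists c : R, (0 <= c)%R /\
    1 - \int[q x]_y (marginal_acc r x y)%:E = c%:E.
  move: I0 I1; case: (integral _ _ _) => [s||]//; rewrite !lee_fin => s0 s1.
  by exists (1 - s)%R; split; [lra|rewrite EFinB].
rewrite cE; apply: (@mixture_integral _ _ _ (P x)
  (fun h => \int[q x]_y ((marginal_acc r x y)%:E * h y)) _ _ _ c0 _ _ nh).
  apply: (@pf_mulcomp _ _ _ _ _ _ (marginal_acc r x) id (pf_integral (q x))) => //.
  by move=> y; exact: marginal_acc_ge0.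
by move=> A mA; rewrite hP// -cE integral_inE.
Qed.

Variables (W : set R) (Q : R.-pker X ~> R).
Hypotheses (mW : measurable W) (W_ge0 : forall w, W w -> (0 <= w)%R).
Hypothesis hQ : weight_kernel W Q.

Lemma pseudo_target_integral (pit : probability (X * R)%type R)
    (h : X * R -> \bar R) :
  is_pseudo_target pi Q pit -> nnmeas h ->
  \int[pit]_z h z = \int[pi]_x \int[Q x]_w ((Num.max 0 w)%:E * h (x, w)).
Proof.
move=> hpit nh.
have mp : measurable_fun setT (fun z : X * R => Num.max 0 z.2)%R.
  by apply: measurable_maxr => //; exact: measurable_cst.
apply: (positive_functional_eq (pf_integral pit)
  (@pf_mulcomp _ _ _ _ _ _ (fun z : X * R => Num.max 0 z.2)%R id
    (pf_kernel Q (pf_integral pi)) _ mp _)) => //.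
  by move=> z; rewrite le_max lexx.
move=> A mA; rewrite integral_indic// setIT; apply: (eq_trans (hpit A mA)).
have nA : nnmeas (fun z : X * R => (Num.max 0 z.2)%:E * (\1_A z)%:E).
  apply: nnmeasM; last exact: nnmeas_indic.
  by apply: nnmeas_EFin => // z; rewrite le_max lexx.
apply: eq_integral => x _; rewrite integral_inE.
apply: (weight_integral_ext mW W_ge0 hQ).
- apply: emeasurable_funM => //.
  by case: (nnmeas_indic R (measurable_xsection x mA)).
- exact: (nnmeas_measurable (nnmeas_pair1 x nA)).
- move=> w w0 /=; rewrite (max_idPr w0); congr (_ * _%:E).
  by rewrite !indicE mem_xsection.
Qed.

Lemma nnmeas_pseudo_acc : nnmeas (fun s : (X * R) * (X * R) =>
  (pseudo_acc r s.1.1 s.1.2 s.2.1 (Num.max 0 s.2.2))%:E).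
Proof.
have m11 : measurable_fun setT (fun s : (X * R) * (X * R) => s.1.1).
  exact: (measurableT_comp measurable_fst measurable_fst).
have m12 : measurable_fun setT (fun s : (X * R) * (X * R) => s.1.2).
  exact: (measurableT_comp measurable_snd measurable_fst).
have m21 : measurable_fun setT (fun s : (X * R) * (X * R) => s.2.1).
  exact: (measurableT_comp measurable_fst measurable_snd).
have m22 : measurable_fun setT (fun s : (X * R) * (X * R) => s.2.2).
  exact: (measurableT_comp measurable_snd measurable_snd).
apply: nnmeas_EFin => [s|].
  rewrite /pseudo_acc; case: ifPn => // w0; rewrite le_min ler01/=.
  by rewrite mulr_ge0// divr_ge0 ?(ltW w0)// le_max lexx.
(* A real power of w replaces its inverse, for the sake of measurability. *)
rewrite (_ : (fun _ => _) = (fun s : (X * R) * (X * R) => if (0 < s.1.2)%R then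
    Num.min 1 (r (s.1.1, s.2.1) * (Num.max 0 s.2.2 * (s.1.2 `^ (-1))))
    else 1)%R); last first.
  apply/funext => s; rewrite /pseudo_acc; case: ifPn => // w0.
  by rewrite powR_inv1// ltW.
apply: measurable_fun_ifT.
- by apply: measurable_fun_ltr => //; exact: measurable_cst.
- apply: measurable_minr; first exact: measurable_cst.
  apply: measurable_funM.
    by apply: (measurableT_comp mr); exact: measurable_fun_pair.
  apply: measurable_funM; first by apply: measurable_maxr => //; exact: measurable_cst.
  exact: (measurableT_comp (measurable_powR _)).
- exact: measurable_cst.
Qed.

Lemma pseudo_acc_le1 x w y u : (pseudo_acc r x w y u <= 1)%R.
Proof. by rewrite /pseudo_acc; case: ifPn => // _; rewrite ge_min lexx. Qed.

Lemma measurable_pseudo_acc x w y : measurable_fun setT (pseudo_acc r x w y).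
Proof.
rewrite /pseudo_acc; case: (0 < w)%R; last exact: measurable_cst.
apply: measurable_minr; first exact: measurable_cst.
apply: measurable_funM; first exact: measurable_cst.
exact: (measurable_funM (f := id) (g := cst w^-1)%R).
Qed.

Lemma pseudo_kernel_integral (Pt : R.-pker (X * R)%type ~> (X * R)%type) x w
    (h : X * R -> \bar R) :
  is_pseudo_kernel q r Q Pt -> nnmeas h ->
  \int[Pt (x, w)]_z h z =
    \int[q x]_y \int[Q y]_u ((pseudo_acc r x w y (Num.max 0 u))%:E * h (y, u))
    + h (x, w) *
      (1 - \int[q x]_y \int[Q y]_u (pseudo_acc r x w y (Num.max 0 u))%:E).
Proof.
move=> hPt nh.
have na : nnmeas (fun z : X * R => (pseudo_acc r x w z.1 (Num.max 0 z.2))%:E).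
  exact: (nnmeas_pair1 (x, w) nnmeas_pseudo_acc).
have nay y : nnmeas (fun u : R => (pseudo_acc r x w y (Num.max 0 u))%:E).
  exact: (nnmeas_pair1 y na).
have nQ : nnmeas (fun y => \int[Q y]_u (pseudo_acc r x w y (Num.max 0 u))%:E).
  exact: (nnmeas_kernel Q na).
have accE y (A : set R) : measurable A ->
    \int[Q y]_(u in A) (pseudo_acc r x w y u)%:E =
    \int[Q y]_u ((pseudo_acc r x w y (Num.max 0 u))%:E * (\1_A u)%:E).
  move=> mA; rewrite integral_inE; apply: (weight_integral_ext mW W_ge0 hQ).
  - apply: emeasurable_funM.
      by apply/measurable_EFinP; exact: measurable_pseudo_acc.
    by apply/measurable_EFinP.
  - apply: emeasurable_funM; first exact: (nnmeas_measurable (nay y)).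
    by apply/measurable_EFinP.
  - by move=> u u0; rewrite (max_idPr u0).
have accTE y : \int[Q y]_u (pseudo_acc r x w y u)%:E =
    \int[Q y]_u (pseudo_acc r x w y (Num.max 0 u))%:E.
  rewrite accE//; apply: eq_integral => u _.
  by rewrite indicE in_setT mule1.
have I0 : 0 <= \int[q x]_y \int[Q y]_u (pseudo_acc r x w y (Num.max 0 u))%:E.
  by apply: integral_ge0 => y _; case: nQ.
have I1 : \int[q x]_y \int[Q y]_u (pseudo_acc r x w y (Num.max 0 u))%:E <= 1.
  apply: integral_pker_le => // y; apply: integral_pker_le => // u.
  by rewrite lee_fin pseudo_acc_le1.
have [c [c0 cE]] : exists c : R, (0 <= c)%R /\
    1 - \int[q x]_y \int[Q y]_u (pseudo_acc r x w y (Num.max 0 u))%:E = c%:E.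
  move: I0 I1; case: (integral _ _ _) => [s||]//; rewrite !lee_fin => s0 s1.
  by exists (1 - s)%R; split; [lra|rewrite EFinB].
rewrite cE; apply: (@mixture_integral _ _ _ (Pt (x, w)) (fun h => \int[q x]_y
    \int[Q y]_u ((pseudo_acc r x w y (Num.max 0 u))%:E * h (y, u)))
  _ _ _ c0 _ _ nh).
  refine (@pf_mulcomp _ _ _ _ _
    (fun g : X * R -> \bar R => \int[q x]_y \int[Q y]_u g (y, u))
    (fun z : X * R => pseudo_acc r x w z.1 (Num.max 0 z.2)%R) id
    (pf_kernel Q (pf_integral (q x))) _ _ _) => //.
  - by move=> z; have [/(_ z)] := na; rewrite lee_fin.
  - by case: na => _ /measurable_EFinP.
move=> A mA; rewrite -cE.
have E1 : \int[q x]_y \int[Q y]_(u in xsection A y) (pseudo_acc r x w y u)%:E =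
    \int[q x]_y \int[Q y]_u ((pseudo_acc r x w y (Num.max 0 u))%:E *
                             (\1_A (y, u))%:E).
  apply: eq_integral => y _; rewrite accE//; last exact: measurable_xsection.
  by apply: eq_integral => u _; rewrite !indicE mem_xsection.
have E2 : \int[q x]_y \int[Q y]_u (pseudo_acc r x w y u)%:E =
    \int[q x]_y \int[Q y]_u (pseudo_acc r x w y (Num.max 0 u))%:E.
  by apply: eq_integral => y _; rewrite accTE.
apply: (eq_trans (hPt x w A mA)).
apply: (f_equal2 (fun a b => a + \d_(x, w) A * (1 - b)) E1 E2).
Qed.

End kernels.

(** * Reversal of the proposal flow *)

Section mh_ratio.
Context d (X : measurableType d) (R : realType).
Variables (pi : probability X R) (q : R.-pker X ~> X) (r : X * X -> R).
Hypothesis hr : mh_ratio pi q r.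

Lemma mh_ratio_measurable : measurable_fun setT r. Proof. by case: hr. Qed.

Lemma mh_ratio_ge0 z : (0 <= r z)%R.
Proof.
case: hr => _ [S [_ _ _ _ [rpos r0]]]; case: z => x y.
by have [/rpos[/ltW]|/r0 ->] := pselect (S (x, y)).
Qed.

Lemma mh_ratioV x y : (r (x, y) != 0 -> r (x, y) * r (y, x) = 1)%R.
Proof.
case: hr => _ [S [_ _ _ _ [rpos r0]]] rxy.
have [/rpos[]//|/r0 rxy0] := pselect (S (x, y)).
by rewrite rxy0 eqxx in rxy.
Qed.

(** On the set where r > 0, the reversed flow has density r with respect to the
    flow.  A function vanishing where r = 0 lives on that set, and its integral
    against the flow may therefore be computed after exchanging x and y, at the
    price of a factor r.  The density property of r is used nowhere else. *)
Lemma mh_ratio_swap (G : X * X -> \bar R) : nnmeas G ->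
  (forall x y, r (x, y) = 0%R -> G (x, y) = 0) ->
  \int[pi]_x \int[q x]_y ((r (x, y))%:E * G (y, x)) =
  \int[pi]_x \int[q x]_y G (x, y).
Proof.
move=> nG G0; case: (hr) => mr [S [[mS symS] _ _ dens [_ r0]]].
have nGS : nnmeas (fun z : X * X => G (z.2, z.1)).
  by apply: nnmeas_comp nG; exact: measurable_fun_pair.
(* The functionals F |-> integral of F against the reversed flow on S, and
   F |-> integral of r F against the flow; they agree on sets by hypothesis. *)
pose L1 (F : X * X -> \bar R) :=
  \int[pi]_x \int[q x]_y ((\1_S (x, y))%:E * F (y, x)).
pose L2 (F : X * X -> \bar R) := \int[pi]_x \int[q x]_y ((r (x, y))%:E * F (x, y)).
have mswap : measurable_fun setT (fun z : X * X => (z.2, z.1)).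
  exact: measurable_fun_pair.
have p1 : positive_functional L1.
  refine (@pf_mulcomp _ _ _ _ _
    (fun F : X * X -> \bar R => \int[pi]_x \int[q x]_y F (x, y))
    (\1_S) (fun z => (z.2, z.1)) (pf_kernel q (pf_integral pi)) _ _ mswap) => //.
have p2 : positive_functional L2.
  refine (@pf_mulcomp _ _ _ _ _
    (fun F : X * X -> \bar R => \int[pi]_x \int[q x]_y F (x, y))
    r id (pf_kernel q (pf_integral pi)) _ _ _) => //.
  exact: mh_ratio_ge0.
have ind A : measurable A ->
    L1 (fun z => (\1_A z)%:E) = L2 (fun z => (\1_A z)%:E).
  move=> mA.
  have mAS : measurable (A `&` S) by exact: measurableI.
  transitivity (flow_rev pi q (A `&` S)); last first.
    rewrite dens; [|exact: mAS|exact: subIsetr].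
    apply: eq_integral => x _; rewrite integral_inE; apply: eq_integral => y _.
    rewrite !indicE mem_xsection in_setI.
    have [xyS|/negP] := boolP ((x, y) \in S); first by rewrite andbT.
    by rewrite inE => /r0 ->; rewrite !mul0e.
  have mB : measurable [set z : X * X | (A `&` S) (z.2, z.1)].
    by have := mswap measurableT _ mAS; rewrite setTI.
  apply: eq_integral => x _; apply/esym.
  have mBx := measurable_xsection x mB.
  apply: (eq_trans (esym (congr1 (q x) (setIT _)))).
  apply: (eq_trans (esym (integral_indic (q x) measurableT mBx))).
  apply: eq_integral => y _; rewrite !indicE mem_xsection.
  rewrite -EFinM -natrM mulnb; congr (_%:R%:E); congr nat_of_bool.
  apply/idP/idP; rewrite !inE/=.
    by move=> [Ayx /symS Sxy]; apply/andP; rewrite !inE.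
  by move=> /andP[]; rewrite !inE => /symS Syx Ayx.
transitivity (L1 (fun z => G (z.2, z.1))).
  exact: (esym (positive_functional_eq p1 p2 ind nGS)).
apply: eq_integral => x _; apply: eq_integral => y _ /=; rewrite indicE.
have [|/negP] := boolP ((x, y) \in S); first by rewrite mul1e.
by rewrite inE => /r0/G0 ->; rewrite mule0.
Qed.

End mh_ratio.

(** * Fubini and measurability for kernels *)

Section kernel_at.
Context d d' (T : measurableType d) (T' : measurableType d') (R : realType).
Variable (k : R.-pker T ~> T').

(** An alias on which the probability structure of a kernel at a point can be
    declared, so that the Fubini-Tonelli theorem applies to it. *)
Definition kernel_at (x : T) : set T' -> \bar R := k x.

HB.instance Definition _ x := Measure.copy (kernel_at x) (k x).
HB.instance Definition _ x :=
  Measure_isProbability.Build _ _ _ (kernel_at x) (prob_kernel x).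

End kernel_at.

Lemma pker_fubini d d1 d2 (T : measurableType d) (T1 : measurableType d1)
    (T2 : measurableType d2) (R : realType) (k1 : R.-pker T ~> T1)
    (k2 : R.-pker T ~> T2) x1 x2 (f : T1 * T2 -> \bar R) : nnmeas f ->
  \int[k1 x1]_y \int[k2 x2]_z f (y, z) = \int[k2 x2]_z \int[k1 x1]_y f (y, z).
Proof.
move=> [f0 mf].
exact: (@fubini_tonelli _ _ _ _ _ (kernel_at k1 x1) (kernel_at k2 x2)).
Qed.

Section kernel_comp.
Context d d1 d2 (S : measurableType d1) (T : measurableType d)
  (T' : measurableType d2) (R : realType).
Variables (k : R.-pker T ~> T') (phi : S -> T).

(** Many integrals below are taken against the kernel at one coordinate of a
    tuple.  Viewed as a kernel on the whole tuple, they are measurable in it by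
    nnmeas_kernel. *)
Definition kernel_comp (mphi : measurable_fun setT phi) (s : S) :
  {measure set T' -> \bar R} := k (phi s).

Hypothesis mphi : measurable_fun setT phi.

Let measurable_kernel_comp U : measurable U ->
  measurable_fun [set: S] (kernel_comp mphi ^~ U).
Proof. by move=> mU; exact: (measurableT_comp (measurable_kernel k U mU)). Qed.

HB.instance Definition _ := isKernel.Build _ _ _ _ _ (kernel_comp mphi)
  measurable_kernel_comp.

HB.instance Definition _ := Kernel_isProbability.Build _ _ _ _ _
  (kernel_comp mphi) (fun s => prob_kernel (phi s)).

Lemma nnmeas_kernel_comp (f : S * T' -> \bar R) :
  nnmeas f -> nnmeas (fun s => \int[k (phi s)]_y f (s, y)).
Proof. exact: (nnmeas_kernel (kernel_comp mphi)). Qed.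

End kernel_comp.

Ltac measurable_proj := repeat first
  [ exact: measurable_fst | exact: measurable_snd | exact: measurable_id
  | apply: measurable_fun_pair
  | apply: (measurableT_comp measurable_fst)
  | apply: (measurableT_comp measurable_snd) ].

(** * Invariance of the targets *)

(** What the accepted moves bring on average to a function is exactly what they
    take away, so the mass kept by rejections restores the integral of h. *)
Lemma rejection_invariant d (E : measurableType d) (R : realType)
    (mu : probability E R) (T A a h : E -> \bar R) :
  nnmeas A -> nnmeas a -> nnmeas h -> (forall z, a z <= 1) ->
  (forall z, T z = A z + h z * (1 - a z)) ->
  \int[mu]_z A z = \int[mu]_z (h z * a z) ->
  \int[mu]_z T z = \int[mu]_z h z.
Proof.
move=> nA na nh a1 TE Aa.
have afin z : a z \is a fin_num.
  by rewrite ge0_fin_numE ?(le_lt_trans (a1 z)) ?ltry//; case: na.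
have nb : nnmeas (fun z => 1 - a z).
  split=> [z|]; first by rewrite sube_ge0// afin.
  by apply: emeasurable_funB; [exact: measurable_cst|case: na].
transitivity (\int[mu]_z (A z + h z * (1 - a z))); first by apply: eq_integral => z _.
rewrite nnmeas_integralD//; last exact: nnmeasM.
rewrite Aa -nnmeas_integralD//; [|exact: nnmeasM|exact: nnmeasM].
apply: eq_integral => z _; rewrite -ge0_muleDr ?(nnmeas_ge0 _ na) ?(nnmeas_ge0 _ nb)//.
by rewrite addeC subeK ?mule1.
Qed.

Section invariance.
Context d (X : measurableType d) (R : realType).
Variables (pi : probability X R) (q : R.-pker X ~> X) (r : X * X -> R).
Hypothesis hr : mh_ratio pi q r.

Let mr := mh_ratio_measurable hr.
Let r0 := mh_ratio_ge0 hr.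

(** Detailed balance at the level of acceptance probabilities: since
    r(x, y) r(y, x) = 1, multiplying by r(x, y) exchanges the two arguments of
    the minimum. *)
Lemma mulr_min1_ratio x y (a b : R) : (0 <= a)%R -> (0 <= b)%R ->
  (r (x, y) * Num.min a (r (y, x) * b) = Num.min b (r (x, y) * a))%R.
Proof.
move=> a0 b0; have [rxy|rxy] := eqVneq (r (x, y)) 0%R.
  by rewrite rxy !mul0r (min_idPr b0).
have rp : (0 < r (x, y))%R by rewrite lt_neqAle eq_sym rxy r0.
by rewrite minr_pMr ?(ltW rp)// mulrA (mh_ratioV hr rxy) mul1r minC.
Qed.

Lemma marginal_invariant (P : R.-pker X ~> X) (h : X -> \bar R) :
  is_marginal_kernel q r P -> nnmeas h ->
  \int[pi]_x \int[P x]_y h y = \int[pi]_x h x.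
Proof.
move=> hP nh; pose a x := \int[q x]_y (marginal_acc r x y)%:E.
have nacc := nnmeas_marginal_acc mr r0.
have nG : nnmeas (fun z : X * X => (marginal_acc r z.1 z.2)%:E * h z.2).
  by apply: nnmeasM => //; apply: nnmeas_comp nh; exact: measurable_snd.
have nG' : nnmeas (fun z : X * X => (marginal_acc r z.1 z.2)%:E * h z.1).
  by apply: nnmeasM => //; apply: nnmeas_comp nh; exact: measurable_fst.
apply: (@rejection_invariant _ _ _ _ _
    (fun x => \int[q x]_y ((marginal_acc r x y)%:E * h y)) a) => //.
- exact: (nnmeas_kernel q nG).
- exact: (nnmeas_kernel q nacc).
- move=> x; apply: integral_pker_le => [|y]; first exact: (nnmeas_pair1 x nacc).
  by rewrite lee_fin marginal_acc_le1.
- by move=> x; exact: marginal_kernel_integral.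
transitivity (\int[pi]_x \int[q x]_y ((marginal_acc r x y)%:E * h x)); last first.
  apply: eq_integral => x _; rewrite -nnmeas_integralZ ?(nnmeas_ge0 _ nh)//; last first.
    exact: (nnmeas_pair1 x nacc).
  by apply: eq_integral => y _; rewrite muleC.
rewrite -(mh_ratio_swap hr nG') => [|x y rxy]; last first.
  by rewrite /marginal_acc rxy/= (min_idPr ler01) mul0e.
apply: eq_integral => x _; apply: eq_integral => y _ /=.
rewrite muleA -EFinM; congr (_%:E * _); rewrite /marginal_acc.
by have := @mulr_min1_ratio x y 1%R 1%R ler01 ler01; rewrite !mulr1 => ->.
Qed.

Variables (W : set R) (Q : R.-pker X ~> R).
Hypotheses (mW : measurable W) (W_ge0 : forall w, W w -> (0 <= w)%R).
Hypothesis hQ : weight_kernel W Q.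

(** The acceptance probability multiplied by the density w of the pseudo-marginal
    target.  Unlike the acceptance probability, it makes sense at w = 0 without a
    convention and is symmetric under the reversal of the flow. *)
Let wmin (x : X) (w : R) (y : X) (u : R) : R :=
  Num.min (Num.max 0 w)%R (r (x, y) * Num.max 0 u)%R.

Let max0_ge0 (w : R) : (0 <= Num.max 0 w)%R. Proof. by rewrite le_max lexx. Qed.

Let wmin_ge0 x w y u : (0 <= wmin x w y u)%R.
Proof. by rewrite le_min max0_ge0 mulr_ge0. Qed.

Lemma weight_accE x w y u : (Num.max 0 w * pseudo_acc r x w y (Num.max 0 u) =
  Num.min (Num.max 0 w) (r (x, y) * Num.max 0 u))%R.
Proof.
rewrite /pseudo_acc; case: ltP => w0; last by rewrite mul0r (min_idPl _)// mulr_ge0.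
by rewrite minr_pMr ?(ltW w0)// mulr1 [(w * _)%R]mulrC -mulrA divfK ?gt_eqF.
Qed.

Let nnmeas_wmin : nnmeas (fun s : (X * R) * (X * R) =>
  (wmin s.1.1 s.1.2 s.2.1 s.2.2)%:E).
Proof.
apply: nnmeas_EFin => [s|]; first exact: wmin_ge0.
apply: measurable_minr.
  by apply: measurable_maxr; [exact: measurable_cst|measurable_proj].
apply: measurable_funM.
  by apply: (measurableT_comp mr); measurable_proj.
by apply: measurable_maxr; [exact: measurable_cst|measurable_proj].
Qed.

(** The flow of accepted moves of the pseudo-marginal chain, rewritten as an
    integral over the proposal flow, where mh_ratio_swap can be used. *)
Lemma pseudo_flow (F : (X * R) * (X * R) -> \bar R) : nnmeas F ->
  \int[pi]_x \int[Q x]_w ((Num.max 0 w)%:E * \int[q x]_y \int[Q y]_u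
    ((pseudo_acc r x w y (Num.max 0 u))%:E * F ((x, w), (y, u)))) =
  \int[pi]_x \int[q x]_y \int[Q x]_w \int[Q y]_u
    ((wmin x w y u)%:E * F ((x, w), (y, u))).
Proof.
move=> nF; apply: eq_integral => x _.
have nwF := nnmeasM nnmeas_wmin nF.
have naF := nnmeasM (nnmeas_pseudo_acc mr r0) nF.
transitivity (\int[Q x]_w \int[q x]_y \int[Q y]_u
    ((wmin x w y u)%:E * F ((x, w), (y, u)))).
  apply: eq_integral => w _.
  have naFw := nnmeas_pair1 (x, w) naF.
  rewrite -nnmeas_integralZ ?lee_fin//; last exact: (nnmeas_kernel Q naFw).
  apply: eq_integral => y _.
  rewrite -nnmeas_integralZ ?lee_fin//; last exact: (nnmeas_pair1 y naFw).
  by apply: eq_integral => u _; rewrite muleA -EFinM weight_accE.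
apply: (@pker_fubini _ _ _ _ _ _ _ Q q x x (fun z => \int[Q z.2]_u
  ((wmin x z.1 z.2 u)%:E * F ((x, z.1), (z.2, u))))).
apply: (nnmeas_kernel_comp Q measurable_snd (f := fun s : (R * X) * R =>
  (wmin x s.1.1 s.1.2 s.2)%:E * F ((x, s.1.1), (s.1.2, s.2)))).
apply: (nnmeas_comp (phi := fun s : (R * X) * R => ((x, s.1.1), (s.1.2, s.2)))
  _ nwF).
apply: measurable_fun_pair; last by measurable_proj.
by apply: measurable_fun_pair; [exact: measurable_cst|measurable_proj].
Qed.

(** Reversibility of the pseudo-marginal kernel: the flow of accepted moves is
    symmetric. *)
Lemma pseudo_flow_sym (F : (X * R) * (X * R) -> \bar R) : nnmeas F ->
  \int[pi]_x \int[q x]_y \int[Q x]_w \int[Q y]_u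
    ((wmin x w y u)%:E * F ((x, w), (y, u))) =
  \int[pi]_x \int[q x]_y \int[Q x]_w \int[Q y]_u
    ((wmin x w y u)%:E * F ((y, u), (x, w))).
Proof.
move=> nF.
pose G (z : X * X) := \int[Q z.1]_w \int[Q z.2]_u
  ((wmin z.1 w z.2 u)%:E * F ((z.2, u), (z.1, w))).
have nH : nnmeas (fun s : (X * R) * (X * R) =>
    (wmin s.1.1 s.1.2 s.2.1 s.2.2)%:E * F (s.2, s.1)).
  apply: nnmeasM => //.
  by apply: (nnmeas_comp (phi := fun s => (s.2, s.1))) nF; exact: measurable_fun_pair.
have nG : nnmeas G.
  apply: (nnmeas_kernel_comp Q measurable_fst (f := fun s : (X * X) * R =>
    \int[Q s.1.2]_u ((wmin s.1.1 s.2 s.1.2 u)%:E * F ((s.1.2, u), (s.1.1, s.2))))).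
  apply: (nnmeas_kernel_comp Q (phi := fun s : (X * X) * R => s.1.2) _
   (f := fun s : ((X * X) * R) * R =>
     (wmin s.1.1.1 s.1.2 s.1.1.2 s.2)%:E *
     F ((s.1.1.2, s.2), (s.1.1.1, s.1.2)))); first by measurable_proj.
  apply: (nnmeas_comp (phi := fun s : ((X * X) * R) * R =>
     ((s.1.1.1, s.1.2), (s.1.1.2, s.2))) _ nH); by measurable_proj.
rewrite -[RHS](mh_ratio_swap hr nG) => [|x y rxy]; last first.
  rewrite /G/=; apply: integral0_eq => w _; apply: integral0_eq => u _.
  by rewrite /wmin rxy mul0r (min_idPr _)// mul0e.
apply: eq_integral => x _; apply: eq_integral => y _; rewrite /G/=.
have nFxy : nnmeas (fun z : R * R => (wmin x z.1 y z.2)%:E * F ((x, z.1), (y, z.2))).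
  have nwF := nnmeasM nnmeas_wmin nF.
  apply: (nnmeas_comp (phi := fun s : R * R => ((x, s.1), (y, s.2))) _ nwF).
  by apply: measurable_fun_pair; apply: measurable_fun_pair => //; exact: measurable_cst.
have nHx : nnmeas (fun z : R * R => (wmin y z.1 x z.2)%:E * F ((x, z.2), (y, z.1))).
  apply: (nnmeas_comp (phi := fun s : R * R => ((y, s.1), (x, s.2))) _ nH).
  by apply: measurable_fun_pair; apply: measurable_fun_pair => //; exact: measurable_cst.
rewrite (pker_fubini Q Q x y nFxy).
rewrite -nnmeas_integralZ ?lee_fin//; last first.
  exact: (nnmeas_kernel_comp Q (phi := fun _ : R => x) _ nHx).
apply: eq_integral => u _.
rewrite -nnmeas_integralZ ?lee_fin//; last exact: (nnmeas_pair1 u nHx).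
apply: eq_integral => w _; rewrite muleA -EFinM /=; congr (_%:E * _).
by rewrite /wmin mulr_min1_ratio.
Qed.

Lemma pseudo_invariant (pit : probability (X * R)%type R)
    (Pt : R.-pker (X * R)%type ~> (X * R)%type) (h : X * R -> \bar R) :
  is_pseudo_target pi Q pit -> is_pseudo_kernel q r Q Pt -> nnmeas h ->
  \int[pit]_z \int[Pt z]_t h t = \int[pit]_z h z.
Proof.
move=> hpit hPt nh.
pose acc (s : (X * R) * (X * R)) :=
  (pseudo_acc r s.1.1 s.1.2 s.2.1 (Num.max 0 s.2.2))%:E.
have nacc : nnmeas acc := nnmeas_pseudo_acc mr r0.
have nk (F : (X * R) * (X * R) -> \bar R) : nnmeas F ->
    nnmeas (fun z => \int[q z.1]_y \int[Q y]_u F (z, (y, u))).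
  move=> nF; apply: (nnmeas_kernel_comp q measurable_fst
    (f := fun s : (X * R) * X => \int[Q s.2]_u F (s.1, (s.2, u)))).
  apply: (nnmeas_kernel_comp Q measurable_snd
    (f := fun s : ((X * R) * X) * R => F (s.1.1, (s.1.2, s.2)))).
  apply: (nnmeas_comp (phi := fun s : ((X * R) * X) * R => (s.1.1, (s.1.2, s.2)))
    _ nF); by measurable_proj.
have nh2 : nnmeas (fun s : (X * R) * (X * R) => h s.2).
  by apply: nnmeas_comp nh; exact: measurable_snd.
have nh1 : nnmeas (fun s : (X * R) * (X * R) => h s.1).
  by apply: nnmeas_comp nh; exact: measurable_fst.
have nA := nk _ (nnmeasM nacc nh2).
have na := nk _ nacc.
have a1 z : \int[q z.1]_y \int[Q y]_u acc (z, (y, u)) <= 1.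
  case: z => x w; apply: integral_pker_le => [|y].
    exact: (nnmeas_kernel Q (nnmeas_pair1 (x, w) nacc)).
  apply: integral_pker_le => [|u].
    exact: (nnmeas_pair1 y (nnmeas_pair1 (x, w) nacc)).
  by rewrite lee_fin pseudo_acc_le1.
have PtE z : \int[Pt z]_t h t =
    \int[q z.1]_y \int[Q y]_u (acc (z, (y, u)) * h (y, u)) +
    h z * (1 - \int[q z.1]_y \int[Q y]_u acc (z, (y, u))).
  by case: z => x w; exact: (pseudo_kernel_integral mr r0 mW W_ge0 hQ).
apply: (rejection_invariant nA na nh a1 PtE).
rewrite (pseudo_target_integral mW W_ge0 hQ hpit nA).
rewrite (pseudo_target_integral mW W_ge0 hQ hpit (nnmeasM nh na)).
apply: (eq_trans (pseudo_flow nh2)); apply: (eq_trans (pseudo_flow_sym nh2)).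
apply: (eq_trans (esym (pseudo_flow nh1))).
apply: eq_integral => x _; apply: eq_integral => w _; congr (_ * _) => /=.
have naw := nnmeas_pair1 (x, w) nacc.
rewrite -nnmeas_integralZ ?(nnmeas_ge0 _ nh)//; last exact: (nnmeas_kernel Q naw).
apply: eq_integral => y _.
rewrite -nnmeas_integralZ ?(nnmeas_ge0 _ nh)//; last exact: (nnmeas_pair1 y naw).
by apply: eq_integral => u _; rewrite muleC.
Qed.

End invariance.

(** * One step of the pseudo-marginal kernel against the marginal kernel *)

Lemma dist_min_le (R : realDomainType) (a b c e : R) :
  (`|Num.min a b - Num.min c e| <= `|a - c| + `|b - e|)%R.
Proof.
have := ler_norm (a - c); have := ler_norm (c - a).
have := ler_norm (b - e); have := ler_norm (e - b).
rewrite [`|c - a|%R]distrC [`|e - b|%R]distrC => ? ? ? ?.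
by rewrite ler_norml; case: (ltP a b) => ?; case: (ltP c e) => ?; apply/andP; split; lra.
Qed.

(** Replacing the acceptance function a by b moves at most a mass L |a - b|, once
    in the accepted part and once in the rejected part; this explains the
    factor 2. *)
Lemma rejection_perturb d (T : measurableType d) (R : realType)
    (L : (T -> \bar R) -> \bar R) (a b : T -> R) (h : T -> \bar R)
    (c : \bar R) (C : R) :
  positive_functional L ->
  nnmeas (fun z => (a z)%:E) -> nnmeas (fun z => (b z)%:E) ->
  L (fun z => (a z)%:E) <= 1 -> L (fun z => (b z)%:E) <= 1 ->
  nnmeas h -> (forall z, h z <= C%:E) -> 0 <= c -> c <= C%:E ->
  L (fun z => (a z)%:E * h z) + c * (1 - L (fun z => (a z)%:E)) <=
  L (fun z => (b z)%:E * h z) + c * (1 - L (fun z => (b z)%:E)) +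
    (2 * C)%:E * L (fun z => (`|a z - b z|)%:E).
Proof.
move=> pL na nb La1 Lb1 nh hC c0 cC.
have C0 : (0 <= C)%R by rewrite -lee_fin (le_trans c0).
have nab : nnmeas (fun z => (`|a z - b z|)%:E).
  apply: nnmeas_EFin => //; apply: (measurableT_comp (@normr_measurable R setT)).
  by apply: measurable_funB; [case: na|case: nb] => _ /measurable_EFinP.
set D := L (fun z => (`|a z - b z|)%:E).
have step1 : L (fun z => (a z)%:E * h z) <= L (fun z => (b z)%:E * h z) + C%:E * D.
  rewrite /D -(pf_scale pL)// -(pf_add pL).
  - apply: (pf_le pL); first exact: nnmeasM.
      apply: nnmeasD; first exact: nnmeasM.
      by apply: nnmeasM => //; exact: nnmeas_cst.
    move=> z; have := hC z; have := nnmeas_ge0 z nh.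
    case: (h z) => [s||]//; rewrite !lee_fin => s0 sC.
    have := ler_norm (a z - b z)%R; have := normr_ge0 (a z - b z)%R => ? ?.
    have : ((a z - b z) * s <= `|a z - b z| * C)%R.
      apply: (@le_trans _ _ (`|a z - b z| * s)%R); first exact: ler_wpM2r.
      exact: ler_wpM2l.
    by lra.
  - exact: nnmeasM.
  - by apply: nnmeasM => //; exact: nnmeas_cst.
have step2 : L (fun z => (b z)%:E) <= L (fun z => (a z)%:E) + D.
  rewrite /D -(pf_add pL)//; apply: (pf_le pL) => //; first exact: nnmeasD.
  move=> z; rewrite -EFinD lee_fin.
  by have := ler_norm (b z - a z)%R; rewrite distrC; lra.
have step3 : c * (1 - L (fun z => (a z)%:E)) <=
    c * (1 - L (fun z => (b z)%:E)) + C%:E * D.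
  have Dy : D <= L (fun z => (a z)%:E) + L (fun z => (b z)%:E).
    rewrite /D -(pf_add pL)//; apply: (pf_le pL) => //; first exact: nnmeasD.
    move=> z; rewrite -EFinD lee_fin; apply: (le_trans (ler_normB _ _)).
    have a0 : (0 <= a z)%R by rewrite -lee_fin; exact: (nnmeas_ge0 z na).
    have b0 : (0 <= b z)%R by rewrite -lee_fin; exact: (nnmeas_ge0 z nb).
    by rewrite !ger0_norm.
  move: Dy step2 La1 Lb1 (pf_ge0 pL na) (pf_ge0 pL nb) (pf_ge0 pL nab).
  rewrite -/D.
  case: (D) => [D'||]; case: (L _) => [sa||]//; case: (L _) => [sb||]//.
  move=> _; case: c c0 cC => [c'||]//.
  rewrite -!EFinD -!EFinM !lee_fin => c0 cC ba a1 b1 a0 b0 D0.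
  have : (c' * (sb - sa) <= C * D')%R.
    apply: (@le_trans _ _ (c' * D')%R); last exact: ler_wpM2r.
    by apply: ler_wpM2l => //; lra.
  by lra.
apply: (le_trans (leeD step1 step3)); rewrite addeACA leeD2l//.
by rewrite -ge0_muleDl ?lee_fin// -EFinD;
  apply: lee_wpmul2r; [exact: (pf_ge0 pL)|rewrite lee_fin; lra].
Qed.

Section discrepancy.
Context d (X : measurableType d) (R : realType).
Variables (pi : probability X R) (q : R.-pker X ~> X) (r : X * X -> R).
Hypothesis hr : mh_ratio pi q r.
Variables (W : set R) (Q : R.-pker X ~> R).
Hypotheses (mW : measurable W) (W_ge0 : forall w, W w -> (0 <= w)%R).
Hypothesis hQ : weight_kernel W Q.

Let mr := mh_ratio_measurable hr.
Let r0 := mh_ratio_ge0 hr.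

(** All errors in the comparison with the marginal chain are bounded by the mean
    of this quantity under pi. *)
Definition weight_error (x : X) : \bar R := \int[Q x]_w (`|1 - w|%R)%:E.

Definition acc_error (z : X * R) : \bar R := \int[q z.1]_y \int[Q y]_u
  (`|pseudo_acc r z.1 z.2 y (Num.max 0 u) - marginal_acc r z.1 y|%R)%:E.

Let max0_ge0 (w : R) : (0 <= Num.max 0 w)%R. Proof. by rewrite le_max lexx. Qed.

Let nnmeas_dist1 : nnmeas (fun w : R => (`|1 - w|%R)%:E).
Proof.
apply: nnmeas_EFin => //; apply: (measurableT_comp (@normr_measurable R setT)).
by apply: measurable_funB => //; exact: measurable_cst.
Qed.

Lemma nnmeas_weight_error : nnmeas weight_error.
Proof.
apply: (nnmeas_kernel Q (f := fun z : X * R => (`|1 - z.2|%R)%:E)).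
by apply: (nnmeas_comp _ nnmeas_dist1); exact: measurable_snd.
Qed.

Lemma integral_weight_pos x : \int[Q x]_w (Num.max 0 w)%:E = 1.
Proof.
rewrite -(hQ.2 x); apply: (weight_integral_ext mW W_ge0 hQ).
- apply/measurable_EFinP.
  by apply: measurable_maxr => //; exact: measurable_cst.
- exact/measurable_EFinP.
- by move=> w w0; rewrite (max_idPr w0).
Qed.

(** |1 - w| <= 1 + w, and the weights have mean 1. *)
Lemma weight_error_le2 x : weight_error x <= 2%:E.
Proof.
have nmax : nnmeas (fun w : R => (Num.max 0 w)%:E).
  by apply: nnmeas_EFin => //; apply: measurable_maxr => //; exact: measurable_cst.
have n1 : nnmeas (fun _ : R => 1 : \bar R) by exact: nnmeas_cst.
apply: (@le_trans _ _ (\int[Q x]_w (1 + (Num.max 0 w)%:E))); last first.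
  by rewrite nnmeas_integralD// integral_pker_cst integral_weight_pos -EFinD.
rewrite /weight_error (weight_integral_ext mW W_ge0 hQ x (g := fun w =>
   (`|1 - Num.max 0 w|%R)%:E)).
- apply: le_nnmeas_integral; last 1 first.
  + move=> w; rewrite -EFinD lee_fin (le_trans (ler_normB _ _))// normr1.
    by rewrite ger0_norm.
  + apply: (nnmeas_comp (phi := fun w : R => Num.max 0%R w) _ nnmeas_dist1).
    by apply: measurable_maxr => //; exact: measurable_cst.
  + exact: nnmeasD.
- by case: nnmeas_dist1.
- apply: (nnmeas_measurable (nnmeas_comp (phi := fun w : R => Num.max 0%R w) _ nnmeas_dist1)).
  by apply: measurable_maxr => //; exact: measurable_cst.
- by move=> w w0; rewrite (max_idPr w0).
Qed.

Let nnmeas_acc_dist : nnmeas (fun s : (X * R) * (X * R) =>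
  (`|pseudo_acc r s.1.1 s.1.2 s.2.1 (Num.max 0 s.2.2) -
     marginal_acc r s.1.1 s.2.1|%R)%:E).
Proof.
apply: nnmeas_EFin => //; apply: (measurableT_comp (@normr_measurable R setT)).
apply: measurable_funB.
  by case: (nnmeas_pseudo_acc mr r0) => _ /measurable_EFinP.
have := @nnmeas_comp _ _ _ _ _ _
  (fun s : (X * R) * (X * R) => (s.1.1, s.2.1)) _ (nnmeas_marginal_acc mr r0).
case; last by move=> _ /measurable_EFinP.
by measurable_proj.
Qed.

Lemma nnmeas_acc_error : nnmeas acc_error.
Proof.
apply: (nnmeas_kernel_comp q measurable_fst (f := fun s : (X * R) * X =>
  \int[Q s.2]_u (`|pseudo_acc r s.1.1 s.1.2 s.2 (Num.max 0 u) -
     marginal_acc r s.1.1 s.2|%R)%:E)).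
apply: (nnmeas_kernel_comp Q measurable_snd (f := fun s : ((X * R) * X) * R =>
  (`|pseudo_acc r s.1.1.1 s.1.1.2 s.1.2 (Num.max 0 s.2) -
     marginal_acc r s.1.1.1 s.1.2|%R)%:E)).
apply: (nnmeas_comp (phi := fun s : ((X * R) * X) * R => (s.1.1, (s.1.2, s.2)))
  _ nnmeas_acc_dist); by measurable_proj.
Qed.

(** Compare both min(w, r u) and w min(1, r) with min(1, r). *)
Let weighted_acc_dist x w y u :
  (Num.max 0 w * `|pseudo_acc r x w y (Num.max 0 u) - marginal_acc r x y| <=
   2 * `|1 - w| + r (x, y) * `|1 - u|)%R.
Proof.
have rxy := r0 (x, y).
have clamp (v : R) : (`|Num.max 0 v - 1| <= `|1 - v|)%R.
  have := ler_norm (1 - v)%R; have := ler_norm (v - 1)%R.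
  rewrite distrC ler_norml => ? ?.
  by case: (ltP 0%R v) => ?; apply/andP; split; lra.
rewrite -[X in (X * _)%R](ger0_norm (max0_ge0 w)) -normrM mulrBr (weight_accE hr).
set t := marginal_acc r x y.
have t0 : (0 <= t)%R by exact: marginal_acc_ge0.
have t1 : (t <= 1)%R by exact: marginal_acc_le1.
rewrite (_ : (_ - _)%R = (Num.min (Num.max 0 w) (r (x, y) * Num.max 0 u) -
  Num.min 1 (r (x, y)) + (1 - Num.max 0 w) * t)%R); last first.
  by rewrite /t /marginal_acc; ring.
apply: (le_trans (ler_normD _ _)).
have A1 : (`|Num.min (Num.max 0 w) (r (x, y) * Num.max 0 u) -
    Num.min 1 (r (x, y))| <= `|1 - w| + r (x, y) * `|1 - u|)%R.
  apply: (le_trans (dist_min_le _ _ _ _)); apply: lerD; first exact: clamp.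
  rewrite -[X in (_ - X)%R]mulr1 -mulrBr normrM (ger0_norm rxy).
  exact: ler_wpM2l.
have A2 : (`|(1 - Num.max 0 w) * t| <= `|1 - w|)%R.
  rewrite normrM (ger0_norm t0) distrC.
  by apply: (le_trans _ (clamp w)); rewrite ler_piMr.
by lra.
Qed.

(** Two of the three copies of the weight error come from |1 - w| in
    weighted_acc_dist; the third one comes from r |1 - u|, in which the flow
    reversal turns the weight error at the proposed point y into the one at the
    current point x. *)
Lemma acc_error_integral (pit : probability (X * R)%type R) :
  is_pseudo_target pi Q pit ->
  \int[pit]_z acc_error z <= 3%:E * \int[pi]_x weight_error x.
Proof.
move=> hpit; have nE := nnmeas_weight_error; have nA := nnmeas_acc_error.
rewrite (pseudo_target_integral mW W_ge0 hQ hpit nA).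
have nr : nnmeas (fun z : X * X => (r z)%:E) by exact: nnmeas_EFin.
have nrE : nnmeas (fun z : X * X => (r z)%:E * weight_error z.2).
  by apply: nnmeasM => //; apply: nnmeas_comp nE; exact: measurable_snd.
have nqrE := nnmeas_kernel q nrE.
have n2E : nnmeas (fun x => 2%:E * weight_error x).
  by apply: nnmeasM => //; exact: nnmeas_cst.
have bound x : \int[Q x]_w ((Num.max 0 w)%:E * acc_error (x, w)) <=
    2%:E * weight_error x + \int[q x]_y ((r (x, y))%:E * weight_error y).
  set B := \int[q x]_y _.
  have nB : nnmeas (fun _ : R => B) by apply: nnmeas_cst; exact: (nnmeas_ge0 x nqrE).
  have n2d : nnmeas (fun w : R => 2%:E * (`|1 - w|%R)%:E).
    by apply: nnmeasM => //; exact: nnmeas_cst.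
  apply: (@le_trans _ _ (\int[Q x]_w (2%:E * (`|1 - w|%R)%:E + B))); last first.
    by rewrite nnmeas_integralD// integral_pker_cst nnmeas_integralZ.
  have nmax : nnmeas (fun w : R => (Num.max 0 w)%:E).
    by apply: nnmeas_EFin => //; apply: measurable_maxr => //; exact: measurable_cst.
  apply: le_nnmeas_integral.
  - by apply: nnmeasM => //; exact: (nnmeas_pair1 x nA).
  - exact: nnmeasD.
  move=> w; have nxw := nnmeas_pair1 (x, w) nnmeas_acc_dist.
  have nrd : nnmeas (fun z : X * R => (r (x, z.1))%:E * (`|1 - z.2|%R)%:E).
    apply: nnmeasM.
      apply: (nnmeas_comp (phi := fun z : X * R => (x, z.1)) _ nr).
      by apply: measurable_fun_pair; [exact: measurable_cst|exact: measurable_fst].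
    by apply: (nnmeas_comp _ nnmeas_dist1); exact: measurable_snd.
  have c2 : 0 <= 2%:E * (`|1 - w|%R)%:E by rewrite mule_ge0// lee_fin.
  rewrite /acc_error/= -nnmeas_integralZ ?lee_fin//; last exact: (nnmeas_kernel Q nxw).
  apply: (@le_trans _ _ (\int[q x]_y \int[Q y]_u
      (2%:E * (`|1 - w|%R)%:E + (r (x, y))%:E * (`|1 - u|%R)%:E))).
    apply: le_nnmeas_integral.
    - apply: nnmeasM; first by apply: nnmeas_cst; rewrite lee_fin.
      exact: (nnmeas_kernel Q nxw).
    - apply: (nnmeas_kernel Q (f := fun z : X * R => 2%:E * (`|1 - w|%R)%:E +
        (r (x, z.1))%:E * (`|1 - z.2|%R)%:E)).
      by apply: nnmeasD => //; exact: nnmeas_cst.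
    move=> y; rewrite -nnmeas_integralZ ?lee_fin//; last exact: (nnmeas_pair1 y nxw).
    apply: le_nnmeas_integral.
    - apply: nnmeasM; first by apply: nnmeas_cst; rewrite lee_fin.
      exact: (nnmeas_pair1 y nxw).
    - apply: nnmeasD; first exact: nnmeas_cst.
      exact: (nnmeas_pair1 y nrd).
    by move=> u; rewrite -!EFinM -EFinD lee_fin; exact: weighted_acc_dist.
  rewrite -[X in _ <= X + B](integral_pker_cst q x) /B -nnmeas_integralD//.
  - apply: le_nnmeas_integral.
    + apply: (nnmeas_kernel Q (f := fun z : X * R => 2%:E * (`|1 - w|%R)%:E +
        (r (x, z.1))%:E * (`|1 - z.2|%R)%:E)).
      by apply: nnmeasD => //; exact: nnmeas_cst.
    + by apply: nnmeasD; [exact: nnmeas_cst|exact: (nnmeas_pair1 x nrE)].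
    move=> y; rewrite nnmeas_integralD//.
    + by rewrite integral_pker_cst nnmeas_integralZ ?lee_fin.
    + exact: (nnmeas_pair1 y nrd).
  - exact: (nnmeas_pair1 x nrE).
apply: (@le_trans _ _ (\int[pi]_x (2%:E * weight_error x +
    \int[q x]_y ((r (x, y))%:E * weight_error y)))).
  apply: le_nnmeas_integral => //; last exact: nnmeasD.
  apply: (nnmeas_kernel Q (f := fun z : X * R => (Num.max 0 z.2)%:E * acc_error z)).
  apply: nnmeasM => //; apply: nnmeas_EFin => [z|]; first exact: max0_ge0.
  by apply: measurable_maxr; [exact: measurable_cst|exact: measurable_snd].
rewrite nnmeas_integralD// nnmeas_integralZ//.
rewrite (_ : 3%:E = 2%:E + 1)//; last by rewrite -EFinD; congr (_%:E); ring.
rewrite ge0_muleDl//.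
rewrite leeD2l// mul1e.
(* The function to be reversed has to vanish where r does, whence the
   indicator of N. *)
pose N := r @^-1` [set~ 0%R].
have mN : measurable N.
  by have := mr measurableT (measurableC (measurable_set1 0%R)); rewrite setTI.
have N0 x y : r (x, y) = 0%R -> \1_N (x, y) = 0%R :> R.
  by move=> rxy; rewrite indicE memNset// => /(_ rxy).
have N1 x y : r (x, y) != 0%R -> \1_N (x, y) = 1%R :> R.
  by move=> /eqP rxy; rewrite indicE mem_set.
move: N mN N0 N1 => N mN N0 N1.
have nG : nnmeas (fun z : X * X => (\1_N z)%:E * weight_error z.1).
  apply: nnmeasM; first exact: nnmeas_indic.
  by apply: nnmeas_comp nE; exact: measurable_fst.
have swapE : \int[pi]_x \int[q x]_y ((r (x, y))%:E * weight_error y) =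
    \int[pi]_x \int[q x]_y ((\1_N (x, y))%:E * weight_error x).
  apply: eq_trans (mh_ratio_swap hr nG _) => [|x y /N0 ->]; last by rewrite mul0e.
  apply: eq_integral => x _; apply: eq_integral => y _ /=.
  have [rxy|rxy] := eqVneq (r (x, y)) 0%R; first by rewrite rxy !mul0e.
  rewrite N1 ?mul1e//; apply/eqP => ryx.
  by have := mh_ratioV hr rxy; rewrite ryx mulr0 => /eqP; rewrite eq_sym oner_eq0.
rewrite swapE; apply: (le_nnmeas_integral pi (nnmeas_kernel q nG) nE).
move=> x; apply: (@le_trans _ _ (\int[q x]_y weight_error x)); last first.
  by rewrite integral_pker_cst.
apply: le_nnmeas_integral; first exact: (nnmeas_pair1 x nG).
  by apply: nnmeas_cst; case: nE.
move=> y; rewrite -[leRHS]mul1e; apply: lee_wpmul2r; first by case: nE.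
by rewrite lee_fin indicE lern1 leq_b1.
Qed.

Lemma pseudo_marginal_perturb (P : R.-pker X ~> X)
    (Pt : R.-pker (X * R)%type ~> (X * R)%type) (h : X -> \bar R) (C : R) x w :
  is_marginal_kernel q r P -> is_pseudo_kernel q r Q Pt -> nnmeas h ->
  (forall x, h x <= C%:E) ->
  (\int[Pt (x, w)]_z h z.1 <=
     \int[P x]_y h y + (2 * C)%:E * acc_error (x, w)) /\
  (\int[P x]_y h y <=
     \int[Pt (x, w)]_z h z.1 + (2 * C)%:E * acc_error (x, w)).
Proof.
move=> hP hPt nh hC.
pose L (f : X * R -> \bar R) := \int[q x]_y \int[Q y]_u f (y, u).
have pL : positive_functional L := pf_kernel Q (pf_integral (q x)).
pose a (z : X * R) := pseudo_acc r x w z.1 (Num.max 0 z.2)%R.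
pose b (z : X * R) := marginal_acc r x z.1.
have na : nnmeas (fun z => (a z)%:E) by exact: (nnmeas_pair1 (x, w) (nnmeas_pseudo_acc mr r0)).
have nb : nnmeas (fun z => (b z)%:E).
  apply: (nnmeas_comp (phi := fun z : X * R => (x, z.1)) _ (nnmeas_marginal_acc mr r0)).
  by apply: measurable_fun_pair; [exact: measurable_cst|exact: measurable_fst].
have L1 f : nnmeas f -> (forall z, f z <= 1) -> L f <= 1.
  move=> nf f1; apply: integral_pker_le => [|y]; first exact: nnmeas_kernel.
  by apply: integral_pker_le => //; exact: nnmeas_pair1.
have La1 : L (fun z => (a z)%:E) <= 1.
  by apply: L1 => // z; rewrite lee_fin; exact: pseudo_acc_le1.
have Lb1 : L (fun z => (b z)%:E) <= 1.
  by apply: L1 => // z; rewrite lee_fin; exact: marginal_acc_le1.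
have nh1 : nnmeas (fun z : X * R => h z.1).
  by apply: nnmeas_comp nh; exact: measurable_fst.
have PtE : \int[Pt (x, w)]_z h z.1 =
    L (fun z => (a z)%:E * h z.1) + h x * (1 - L (fun z => (a z)%:E)).
  exact: (pseudo_kernel_integral mr r0 mW W_ge0 hQ).
have PE : \int[P x]_y h y =
    L (fun z => (b z)%:E * h z.1) + h x * (1 - L (fun z => (b z)%:E)).
  rewrite (marginal_kernel_integral mr r0 x hP nh); congr (_ + _ * (1 - _)).
    by apply: eq_integral => y _; rewrite /b/= integral_pker_cst.
  by apply: eq_integral => y _; rewrite /b/= integral_pker_cst.
rewrite PtE PE; split.
  exact: (rejection_perturb pL na nb La1 Lb1 nh1 (fun z => hC z.1)
    (nnmeas_ge0 x nh) (hC x)).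
have -> : acc_error (x, w) = L (fun z => (`|b z - a z|%R)%:E).
  by apply: eq_integral => y _; apply: eq_integral => u _; rewrite distrC.
exact: (rejection_perturb pL nb na Lb1 La1 nh1 (fun z => hC z.1)
  (nnmeas_ge0 x nh) (hC x)).
Qed.

End discrepancy.

(** * Stationary Markov chains *)

Lemma indic_comp T T' (R : realType) (A : set T') (f : T -> T') w :
  \1_A (f w) = \1_(f @^-1` A) w :> R.
Proof. by rewrite !indicE; congr (_%:R); apply/idP/idP; rewrite !inE. Qed.

Section markov.
Context d d' (O : measurableType d) (E : measurableType d') (R : realType).
Variables (mu : probability E R) (K : R.-pker E ~> E) (Pr : probability O R)
  (X : nat -> {mfun O >-> E}).
Hypothesis hX : markov_chain mu K Pr X.

Lemma nnmeas_chain n (h : E -> \bar R) : nnmeas h -> nnmeas (fun w => h (X n w)).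
Proof. by apply: nnmeas_comp. Qed.

Lemma nnmeas_kernel_cst (h : E -> \bar R) :
  nnmeas h -> nnmeas (fun x => \int[K x]_y h y).
Proof.
move=> nh; apply: (nnmeas_kernel K (f := fun z : E * E => h z.2)).
by apply: nnmeas_comp nh; exact: measurable_snd.
Qed.

Lemma past_preimage j n B : (j <= n)%N -> measurable B -> past X n (X j @^-1` B).
Proof. by move=> jn mB; apply: sub_gen_smallest; exists j, B. Qed.

(** The Markov property is first extended from sets to functions in the past
    variable, then, in markov_step, in the future variable. *)
Let markov_indic n j (B : set E) (phi : E -> R) : (j <= n)%N -> measurable B ->
  (forall x, (0 <= phi x)%R) -> measurable_fun setT phi ->
  \int[Pr]_w ((phi (X j w))%:E * (\1_B (X n.+1 w))%:E) =
  \int[Pr]_w ((phi (X j w))%:E * K (X n w) B).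
Proof.
move=> jn mB phi0 mphi.
pose b w : R := \1_B (X n.+1 w).
pose kb w := fine (K (X n w) B).
have KB x : K x B = (fine (K x B))%:E.
  rewrite fineK// ge0_fin_numE//; apply: (@le_lt_trans _ _ 1); last exact: ltry.
  by rewrite -(prob_kernel (s := K) x); apply: le_measure; rewrite ?inE.
have mkb : measurable_fun setT kb.
  apply: (measurableT_comp (fine_measurable measurableT)).
  exact: (measurableT_comp (measurable_kernel K B mB)).
have mb : measurable_fun setT b by exact: (measurableT_comp (measurable_indic mB)).
pose L1 (f : E -> \bar R) := \int[Pr]_w ((b w)%:E * f (X j w)).
pose L2 (f : E -> \bar R) := \int[Pr]_w ((kb w)%:E * f (X j w)).
have p1 : positive_functional L1.
  by apply: (pf_mulcomp (pf_integral Pr)) => // w; rewrite /b indicE ler0n.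
have p2 : positive_functional L2.
  by apply: (pf_mulcomp (pf_integral Pr)) => // w; exact: fine_ge0.
have ind A : measurable A ->
    L1 (fun x => (\1_A x)%:E) = L2 (fun x => (\1_A x)%:E).
  move=> mA; have [_ mark] := hX.
  have mXA : measurable (X j @^-1` A).
    by rewrite -[X in measurable X]setTI; exact: measurable_funP.
  have mXB : measurable (X n.+1 @^-1` B).
    by rewrite -[X in measurable X]setTI; exact: measurable_funP.
  have := mark n (X j @^-1` A) B (past_preimage jn mA) mB.
  rewrite integral_inE => mE.
  transitivity (Pr (X j @^-1` A `&` X n.+1 @^-1` B)).
    have mAB := measurableI _ _ mXA mXB.
    apply: (eq_trans _ (congr1 Pr (setIT _))).
    apply: (eq_trans _ (integral_indic Pr measurableT mAB)).
    apply: eq_integral => w _; rewrite -EFinM /b !indic_comp indicI.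
    by rewrite /= mulrC.
  apply: (eq_trans mE); apply: eq_integral => w _.
  by rewrite /kb -KB indic_comp.
have nphi : nnmeas (fun x => (phi x)%:E) by exact: nnmeas_EFin.
have E12 := positive_functional_eq p1 p2 ind nphi.
transitivity (L1 (fun x => (phi x)%:E)).
  by apply: eq_integral => w _; rewrite muleC.
by rewrite E12; apply: eq_integral => w _; rewrite muleC -KB.
Qed.

(** The future function h may take infinite values: it will be iterated through
    the kernel, which does not preserve finiteness. *)
Lemma markov_step n j (phi : E -> R) (h : E -> \bar R) : (j <= n)%N ->
  (forall x, (0 <= phi x)%R) -> measurable_fun setT phi -> nnmeas h ->
  \int[Pr]_w ((phi (X j w))%:E * h (X n.+1 w)) =
  \int[Pr]_w ((phi (X j w))%:E * \int[K (X n w)]_y h y).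
Proof.
move=> jn phi0 mphi nh.
have mX i : measurable_fun setT (X i) by [].
have mphij : measurable_fun setT (fun w => phi (X j w)) by exact: measurableT_comp.
pose L1 (f : E -> \bar R) := \int[Pr]_w ((phi (X j w))%:E * f (X n.+1 w)).
pose L2 (f : E -> \bar R) :=
  \int[Pr]_w \int[K (X n w)]_y ((phi (X j w))%:E * f y).
have p1 : positive_functional L1 by exact: (pf_mulcomp (pf_integral Pr)).
have p2 : positive_functional L2.
  have mw : measurable_fun setT (fun z : O * E => phi (X j z.1)).
    exact: (measurableT_comp mphij measurable_fst).
  exact: (@pf_mulcomp _ _ _ _ _ (fun f : O * E -> \bar R =>
      \int[Pr]_w \int[K (X n w)]_y f (w, y))
    (fun z : O * E => phi (X j z.1)) snd
    (pf_kernel (kernel_comp K (mX n)) (pf_integral Pr))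
    (fun z => phi0 (X j z.1)) mw measurable_snd).
have L2E f : nnmeas f ->
    L2 f = \int[Pr]_w ((phi (X j w))%:E * \int[K (X n w)]_y f y).
  move=> nf; apply: eq_integral => w _.
  by rewrite nnmeas_integralZ// lee_fin.
have ind A : measurable A ->
    L1 (fun x => (\1_A x)%:E) = L2 (fun x => (\1_A x)%:E).
  move=> mA; rewrite L2E; last exact: nnmeas_indic.
  rewrite /L1 markov_indic//; apply: eq_integral => w _.
  by rewrite integral_indic// setIT.
by rewrite -L2E//; exact: (positive_functional_eq p1 p2 ind nh).
Qed.

Hypothesis inv : forall h : E -> \bar R, nnmeas h ->
  \int[mu]_x \int[K x]_y h y = \int[mu]_x h x.

Lemma stationary_integral n (h : E -> \bar R) :
  nnmeas h -> \int[Pr]_w h (X n w) = \int[mu]_x h x.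
Proof.
have one (f : E -> \bar R) i : \int[Pr]_w f (X i w) = \int[Pr]_w (1%:E * f (X i w)).
  by apply: eq_integral => w _; rewrite mul1e.
elim: n h => [|n ih] h nh.
  rewrite one; have p1 : positive_functional (fun f : E -> \bar R =>
      \int[Pr]_w (1%:E * f (X 0%N w))).
    exact: (pf_mulcomp (w := fun=> 1%R) (pf_integral Pr)).
  apply: (positive_functional_eq p1 (pf_integral mu) _ nh) => A mA.
  apply: (eq_trans (esym (one (fun x => (\1_A x)%:E) 0%N))); have [X0 _] := hX.
  have mXA : measurable (X 0%N @^-1` A).
    by rewrite -[X in measurable X]setTI; exact: measurable_funP.
  rewrite [RHS]integral_indic// setIT; apply: eq_trans (X0 A mA).
  apply: (eq_trans _ (congr1 Pr (setIT _))).
  apply: (eq_trans _ (integral_indic Pr measurableT mXA)).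
  by apply: eq_integral => w _; rewrite indic_comp.
have nK := nnmeas_kernel_cst nh.
rewrite one (@markov_step n n (fun=> 1%R))// -(inv nh) -(ih _ nK).
exact: (esym (one (fun x => \int[K x]_y h y) n)).
Qed.

Lemma stationary_expectation n (g : E -> R) : measurable_fun setT g ->
  \int[Pr]_w (g (X n w))%:E = \int[mu]_x (g x)%:E.
Proof.
move=> mg; have mEg : measurable_fun setT (EFin \o g) by exact/measurable_EFinP.
have np : nnmeas (EFin \o g)^\+ by split=> //; exact: measurable_funepos.
have nm : nnmeas (EFin \o g)^\- by split=> //; exact: measurable_funeneg.
rewrite integralE [RHS]integralE; congr (_ - _).
  rewrite -[RHS](stationary_integral n np).
  by apply: eq_integral => w _; rewrite !funeposE.
rewrite -[RHS](stationary_integral n nm).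
by apply: eq_integral => w _; rewrite !funenegE.
Qed.

Lemma stationary_pair j k (phi : E -> R) (h : E -> \bar R) :
  (forall x, (0 <= phi x)%R) -> measurable_fun setT phi -> nnmeas h ->
  \int[Pr]_w ((phi (X j w))%:E * h (X (j + k)%N w)) =
  \int[Pr]_w ((phi (X 0%N w))%:E * h (X k w)).
Proof.
move=> phi0 mphi; elim: k h => [|k ih] h nh.
  rewrite addn0; have nph : nnmeas (fun x => (phi x)%:E * h x).
    by apply: nnmeasM => //; exact: nnmeas_EFin.
  by rewrite !(stationary_integral _ nph).
rewrite addnS (markov_step (leq_addr k j) phi0 mphi nh).
rewrite (markov_step (leq0n k) phi0 mphi nh).
exact: (ih _ (nnmeas_kernel_cst nh)).
Qed.

End markov.

(** * Covariances and the Cesaro form of the asymptotic variance *)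

Section square_integrable.
Context d (T : measurableType d) (R : realType).
Variable mu : {measure set T -> \bar R}.

Definition square_integrable (f : T -> R) :=
  measurable_fun setT f /\ \int[mu]_x ((f x) ^+ 2)%:E < +oo.

Lemma nnmeas_sqr (f : T -> R) : measurable_fun setT f ->
  nnmeas (fun x => ((f x) ^+ 2)%:E).
Proof.
by move=> mf; apply: nnmeas_EFin => [x|]; [exact: sqr_ge0|exact: measurable_funX].
Qed.

Lemma square_integrable_le (f g : T -> R) : measurable_fun setT f ->
  (forall x, `|f x| <= `|g x|)%R -> square_integrable g -> square_integrable f.
Proof.
move=> mf fg [mg g2]; split=> //; apply: le_lt_trans g2.
apply: le_nnmeas_integral; [exact: nnmeas_sqr|exact: nnmeas_sqr|move=> x].
rewrite lee_fin -(real_normK (num_real (f x))) -(real_normK (num_real (g x))).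
by rewrite ler_pXn2r ?nnegrE.
Qed.

Lemma integrable_mul (f g : T -> R) :
  square_integrable f -> square_integrable g ->
  mu.-integrable setT (fun x => (f x * g x)%:E).
Proof.
move=> [mf f2] [mg g2].
apply: (@le_integrable _ _ _ _ _ measurableT _
    (fun x => ((f x) ^+ 2)%:E + ((g x) ^+ 2)%:E)).
- by apply/measurable_EFinP; exact: measurable_funM.
- move=> x _; rewrite -EFinD !abse_EFin lee_fin.
  rewrite [X in (_ <= X)%R]ger0_norm ?addr_ge0 ?sqr_ge0// normrM.
  rewrite -(real_normK (num_real (f x))) -(real_normK (num_real (g x))).
  have := sqr_ge0 (`|f x| - `|g x|)%R; have := sqr_ge0 (`|f x| + `|g x|)%R.
  have := normr_ge0 (f x); have := normr_ge0 (g x); nra.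
- have nf := nnmeas_sqr mf; have ng := nnmeas_sqr mg.
  apply/integrableP; split; first exact: (nnmeas_measurable (nnmeasD nf ng)).
  rewrite (_ : integral _ _ _ = \int[mu]_x (((f x) ^+ 2)%:E + ((g x) ^+ 2)%:E)).
    by rewrite nnmeas_integralD//; exact: lte_add_pinfty.
  by apply: eq_integral => x _; rewrite gee0_abs// adde_ge0// lee_fin sqr_ge0.
Qed.

End square_integrable.

Section stationary_covariance.
Context d d' (O : measurableType d) (E : measurableType d') (R : realType).
Variables (mu : probability E R) (K : R.-pker E ~> E) (Pr : probability O R)
  (X : nat -> {mfun O >-> E}).
Hypothesis hX : markov_chain mu K Pr X.
Hypothesis inv : forall h : E -> \bar R, nnmeas h ->
  \int[mu]_x \int[K x]_y h y = \int[mu]_x h x.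
Implicit Type f : E -> R.

Lemma square_integrable_chain f n : square_integrable mu f ->
  square_integrable Pr (fun w => f (X n w)).
Proof.
move=> [mf f2]; split; first exact: measurableT_comp.
by rewrite (stationary_integral hX inv n (nnmeas_sqr mf)).
Qed.

(** Stationarity of pairs is known for nonnegative functions; the signed case
    follows by expanding the product of f = p - m into its four nonnegative
    terms. *)
Lemma stationary_cov f j k : square_integrable mu f ->
  \int[Pr]_w (f (X j w) * f (X (j + k)%N w))%:E =
  \int[Pr]_w (f (X 0%N w) * f (X k w))%:E.
Proof.
move=> sf; have mf := sf.1.
pose p x : R := Num.max 0%R (f x); pose m x : R := Num.max 0%R (- f x)%R.
have p0 x : (0 <= p x)%R by rewrite le_max lexx.
have m0 x : (0 <= m x)%R by rewrite le_max lexx.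
have mp : measurable_fun setT p by apply: measurable_maxr => //; exact: measurable_cst.
have mm : measurable_fun setT m.
  by apply: measurable_maxr; [exact: measurable_cst|exact: measurable_funN].
have fpm x : f x = (p x - m x)%R.
  by rewrite /p /m; case: (ltP 0%R (f x)); case: (ltP 0%R (- f x)%R); lra.
have sp : square_integrable mu p.
  apply: (square_integrable_le mp _ sf) => x; rewrite ger0_norm//.
  by rewrite /p ge_max normr_ge0 ler_norm.
have sm : square_integrable mu m.
  apply: (square_integrable_le mm _ sf) => x; rewrite ger0_norm//.
  by rewrite /m ge_max normr_ge0 -normrN ler_norm.
have split2 i n : \int[Pr]_w (f (X i w) * f (X n w))%:E =
    (\int[Pr]_w ((p (X i w))%:E * (p (X n w))%:E) +
     \int[Pr]_w ((m (X i w))%:E * (m (X n w))%:E)) -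
    (\int[Pr]_w ((p (X i w))%:E * (m (X n w))%:E) +
     \int[Pr]_w ((m (X i w))%:E * (p (X n w))%:E)).
  have nX (h : E -> R) l : (forall x, 0 <= h x)%R -> measurable_fun setT h ->
      nnmeas (fun w => (h (X l w))%:E).
    by move=> h0 mh; apply: nnmeas_EFin => //; exact: measurableT_comp.
  have nM (h h' : E -> R) : (forall x, 0 <= h x)%R -> measurable_fun setT h ->
      (forall x, 0 <= h' x)%R -> measurable_fun setT h' ->
      nnmeas (fun w => (h (X i w))%:E * (h' (X n w))%:E).
    by move=> ? ? ? ?; apply: nnmeasM; exact: nX.
  have iM (h h' : E -> R) : square_integrable mu h -> square_integrable mu h' ->
      Pr.-integrable setT (fun w => (h (X i w) * h' (X n w))%:E).
    by move=> ? ?; apply: integrable_mul; exact: square_integrable_chain.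
  rewrite -!nnmeas_integralD; [|exact: nM..].
  rewrite -integralB//; first (apply: eq_integral => w _;
    by rewrite -!EFinM -!EFinD /= !fpm; congr (_%:E); ring).
  - by apply: integrableD => //; exact: iM.
  - by apply: integrableD => //; exact: iM.
have np : nnmeas (fun x => (p x)%:E) by exact: nnmeas_EFin.
have nm : nnmeas (fun x => (m x)%:E) by exact: nnmeas_EFin.
rewrite !split2; congr (_ + _ - (_ + _)).
- exact: (stationary_pair hX inv j k p0 mp np).
- exact: (stationary_pair hX inv j k m0 mm nm).
- exact: (stationary_pair hX inv j k p0 mp nm).
- exact: (stationary_pair hX inv j k m0 mm np).
Qed.

Definition cov f k : R := fine (\int[Pr]_w (f (X 0%N w) * f (X k w))%:E).

Lemma cov_integral f j k : square_integrable mu f ->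
  \int[Pr]_w (f (X j w) * f (X (j + k)%N w))%:E = (cov f k)%:E.
Proof.
move=> sf; rewrite stationary_cov// /cov fineK//.
by apply: integrable_fin_num => //; apply: integrable_mul; exact: square_integrable_chain.
Qed.

Lemma cov0E f : square_integrable mu f ->
  \int[mu]_x ((f x) ^+ 2)%:E = (cov f 0)%:E.
Proof.
move=> sf; rewrite -(cov_integral 0%N 0%N sf).
rewrite -(stationary_integral hX inv 0%N (nnmeas_sqr sf.1)).
by apply: eq_integral => w _; rewrite expr2.
Qed.

Definition cov_sum f n : R := (cov f 0 + 2 * \sum_(1 <= k < n.+1) cov f k)%R.

(** Adding the term of index n + 1 to the sum S_n adds
    f(X_{n+1})^2 + 2 S_n f(X_{n+1}) to its square, the mean of which is
    cov_sum f n. *)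
Lemma integral_square_sum f n : square_integrable mu f ->
  \int[Pr]_w ((\sum_(1 <= k < n.+1) f (X k w)) ^+ 2)%:E =
  (\sum_(0 <= m < n) cov_sum f m)%:E.
Proof.
move=> sf.
have iM i j : Pr.-integrable setT (fun w => (f (X i w) * f (X j w))%:E).
  by apply: integrable_mul; exact: square_integrable_chain.
pose S n w := (\sum_(1 <= k < n.+1) f (X k w))%R.
have Srec m w : S m.+1 w = (S m w + f (X m.+1 w))%R.
  by rewrite /S big_nat_recr.
have iSf m i : Pr.-integrable setT (fun w => (S m w * f (X i w))%:E).
  elim: m => [|m ih].
    rewrite (_ : (fun _ => _) = cst 0); first exact: integrable0.
    by apply/funext => w; rewrite /S big_geq// mul0r.
  rewrite (_ : (fun _ => _) = (fun w => (S m w * f (X i w))%:E +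
    (f (X m.+1 w) * f (X i w))%:E)); first exact: integrableD.
  by apply/funext => w; rewrite Srec mulrDl EFinD.
have ESf m i : (m < i)%N -> \int[Pr]_w (S m w * f (X i w))%:E =
    (\sum_(1 <= k < m.+1) cov f (i - k))%:E.
  elim: m => [_|m ih mi].
    by rewrite big_geq//; apply: integral0_eq => w _; rewrite /S big_geq// mul0r.
  rewrite big_nat_recr//= EFinD -ih ?(ltnW mi)//.
  rewrite -(cov_integral m.+1 _ sf) subnKC ?(ltnW mi)// -integralD//.
  by apply: eq_integral => w _; rewrite Srec mulrDl EFinD.
have iSS m : Pr.-integrable setT (fun w => ((S m w) ^+ 2)%:E).
  elim: m => [|m ih].
    rewrite (_ : (fun _ => _) = cst 0); first exact: integrable0.
    by apply/funext => w; rewrite /S big_geq// expr0n.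
  rewrite (_ : (fun _ => _) = (fun w => (S m w ^+ 2)%:E +
    ((S m w * f (X m.+1 w))%:E + (S m.+1 w * f (X m.+1 w))%:E))).
    by apply: integrableD => //; apply: integrableD.
  apply/funext => w; rewrite -!EFinD; congr (_%:E).
  by rewrite Srec; ring.
elim: n => [|n ih].
  rewrite big_geq//; apply: integral0_eq => w _.
  by rewrite big_geq// expr0n.
rewrite big_nat_recr//= EFinD -ih.
have -> : (cov_sum f n)%:E = (2%:E * \int[Pr]_w (S n w * f (X n.+1 w))%:E +
    \int[Pr]_w (f (X n.+1 w) * f (X n.+1 w))%:E).
  have := cov_integral n.+1 0%N sf; rewrite addn0 => ->.
  rewrite ESf// -EFinM -EFinD.
  congr (_%:E); rewrite /cov_sum addrC; congr (2 * _ + _)%R.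
  rewrite [RHS]big_nat_rev/=; apply: eq_big_nat => k /andP[k1 kn].
  by rewrite add1n subSS subKn// ltnW.
have iSS' := iSS n.
rewrite -integralZl// -integralD//; last exact: integrableZl.
rewrite -integralD//; last by apply: integrableD => //; exact: integrableZl.
apply: eq_integral => w _; rewrite -EFinM -!EFinD; congr (_%:E).
rewrite -[(\sum_(1 <= k < n.+2) f (X k w))%R]/(S n.+1 w).
by rewrite -[(\sum_(1 <= k < n.+1) f (X k w))%R]/(S n w) Srec; ring.
Qed.

Lemma mean_square_sum_cvg f (l : R) : square_integrable mu f ->
  cov_sum f @ \oo --> l ->
  (fun n : nat => (n%:R^-1)%:E *
    \int[Pr]_w ((\sum_(1 <= k < n.+1) f (X k w)) ^+ 2)%:E) @ \oo --> l%:E.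
Proof.
move=> sf sl; rewrite -(cvg_shiftn 1).
have mean_cvg : (EFin \o arithmetic_mean (cov_sum f)) @ \oo --> l%:E.
  by apply: cvg_EFin; [exact: nearW|exact: cesaro sl].
apply: cvg_trans mean_cvg.
by apply: near_eq_cvg; apply: nearW => n /=; rewrite addn1 integral_square_sum.
Qed.

Lemma stationary_sqr f n : square_integrable mu f ->
  \int[Pr]_w ((f (X n w)) ^+ 2)%:E = (fine (\int[mu]_x ((f x) ^+ 2)%:E))%:E.
Proof.
move=> sf; rewrite fineK; first exact: (stationary_integral hX inv n (nnmeas_sqr sf.1)).
by rewrite cov0E.
Qed.

Lemma cov_shift f (c : R) k : square_integrable mu f ->
  cov (fun x => f x - c)%R k =
  (cov f k - 2 * c * fine (\int[mu]_x (f x)%:E) + c ^+ 2)%R.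
Proof.
move=> sf.
have s1 : square_integrable Pr (fun=> 1%R).
  split; first exact: measurable_cst.
  by rewrite integral_cst// expr1n mul1e (le_lt_trans (probability_le1 _ _))// ltry.
have i1 n : Pr.-integrable setT (fun w => (f (X n w))%:E).
  have := integrable_mul (square_integrable_chain n sf) s1.
  by apply: eq_integrable => // w _; rewrite mulr1.
have e1 n : \int[Pr]_w (f (X n w))%:E = (fine (\int[mu]_x (f x)%:E))%:E.
  have fE := stationary_expectation hX inv n sf.1.
  by rewrite -fE fineK//; exact: integrable_fin_num.
have ic (b : R) : Pr.-integrable setT (fun=> b%:E).
  by apply: finite_measure_integrable_cst.
have iff : Pr.-integrable setT (fun w => (f (X 0%N w) * f (X k w))%:E).
  by apply: integrable_mul; exact: square_integrable_chain.
apply: EFin_inj; rewrite EFinD EFinB.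
have cE : \int[Pr]_w (f (X 0%N w) * f (X k w))%:E = (cov f k)%:E.
  exact: (cov_integral 0%N k sf).
have -> : (cov (fun x => f x - c)%R k)%:E =
    \int[Pr]_w ((f (X 0%N w) * f (X k w))%:E + ((- c)%:E * (f (X 0%N w))%:E +
      ((- c)%:E * (f (X k w))%:E + (c ^+ 2)%:E))).
  have EE w : ((f (X 0%N w) - c) * (f (X k w) - c))%:E =
      (f (X 0%N w) * f (X k w))%:E + ((- c)%:E * (f (X 0%N w))%:E +
      ((- c)%:E * (f (X k w))%:E + (c ^+ 2)%:E)).
    by rewrite -!EFinM -!EFinD; congr (_%:E); ring.
  rewrite /cov; under [in LHS]eq_integral do rewrite EE.
  rewrite fineK//; apply: integrable_fin_num => //.
  apply: integrableD => //; apply: integrableD => //; first exact: integrableZl.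
  by apply: integrableD => //; exact: integrableZl.
have icf n := integrableZl measurableT (- c) (i1 n).
have icc := integrableD measurableT (icf k) (ic (c ^+ 2)%R).
rewrite integralD//; last exact: integrableD.
rewrite integralD// integralD// !integralZl// !e1 cE integral_cst//=.
rewrite [Pr _]probability_setT mule1 -!EFinM -!EFinD; congr (_%:E); ring.
Qed.

(** With u = f - g, f f' - g g' = u f' + g u', and Young's inequality bounds each
    product by squares whose means are known by stationarity.  The bound involves
    the stationary law only, through the means of f^2 and (f - g)^2; for
    functions of the first coordinate these are the same for the marginal chain
    and for all pseudo-marginal chains.  A small eta, and then a small u, make it
    arbitrarily small. *)
Lemma cov_approx f g (eta : R) k : (0 < eta)%R -> square_integrable mu f ->
  square_integrable mu g -> (forall x, `|g x| <= `|f x|)%R ->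
  (`|cov f k - cov g k| <= eta * fine (\int[mu]_x ((f x) ^+ 2)%:E) +
    eta^-1 * fine (\int[mu]_x ((f x - g x) ^+ 2)%:E))%R.
Proof.
move=> eta0 sf sg gf.
have mu' : measurable_fun setT (fun x => f x - g x)%R.
  by apply: measurable_funB; [case: sf|case: sg].
have i2 h n : square_integrable mu h ->
    Pr.-integrable setT (fun w => ((h (X n w)) ^+ 2)%:E).
  move=> sh; have sn := square_integrable_chain n sh.
  by have := integrable_mul sn sn; apply: eq_integrable => // w _; rewrite expr2.
have iff h : square_integrable mu h ->
    Pr.-integrable setT (fun w => (h (X 0%N w) * h (X k w))%:E).
  by move=> sh; apply: integrable_mul; exact: square_integrable_chain.
have su : square_integrable mu (fun x => f x - g x)%R.
  split=> //; apply: (@le_lt_trans _ _ (\int[mu]_x (4%:E * ((f x) ^+ 2)%:E))).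
    apply: le_nnmeas_integral; first exact: nnmeas_sqr.
      by apply: nnmeasM; [exact: nnmeas_cst|apply: nnmeas_sqr; case: sf].
    move=> x; rewrite -EFinM lee_fin.
    rewrite -(real_normK (num_real (f x - g x)%R)) -(real_normK (num_real (f x))).
    have := ler_normB (f x) (g x); have := gf x; have := normr_ge0 (f x - g x)%R.
    by have := normr_ge0 (f x); nra.
  rewrite nnmeas_integralZ//; last by apply: nnmeas_sqr; case: sf.
  by rewrite cov0E// -EFinM ltry.
set a := fine (\int[mu]_x ((f x) ^+ 2)%:E).
set b := fine (\int[mu]_x ((f x - g x) ^+ 2)%:E).
rewrite -lee_fin -abse_EFin EFinB -!(cov_integral 0%N k)//.
rewrite -integralB//; [|exact: iff|exact: iff].
pose u x := (f x - g x)%R.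
pose D w := (2^-1 * (eta * f (X 0%N w) ^+ 2 + eta * f (X k w) ^+ 2 +
   eta^-1 * u (X 0%N w) ^+ 2 + eta^-1 * u (X k w) ^+ 2))%R.
have mf n : measurable_fun setT (fun w => f (X n w)).
  by apply: measurableT_comp => //; case: sf.
have mu2 n : measurable_fun setT (fun w => u (X n w)) by exact: measurableT_comp.
have D0 w : (0 <= D w)%R.
  have e0 := ltW eta0; have ei0 : (0 <= eta^-1)%R by rewrite invr_ge0.
  by rewrite mulr_ge0// !addr_ge0// mulr_ge0// sqr_ge0.
have mD : measurable_fun setT D.
  apply: measurable_funM; first exact: measurable_cst.
  by apply: measurable_funD; [apply: measurable_funD; [apply: measurable_funD|]|];
    (apply: measurable_funM; [exact: measurable_cst|exact: measurable_funX]).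
have young (s t : R) : (`|s * t| <= 2^-1 * (eta * s ^+ 2 + eta^-1 * t ^+ 2))%R.
  have : (0 <= eta^-1 * (eta * `|s| - `|t|) ^+ 2)%R.
    by rewrite mulr_ge0 ?sqr_ge0// invr_ge0 ltW.
  rewrite normrM -(real_normK (num_real s)) -(real_normK (num_real t)).
  rewrite (_ : (eta^-1 * _ ^+ 2) = eta * `|s| ^+ 2 - 2 * (`|s| * `|t|) + eta^-1 * `|t| ^+ 2)%R.
    by lra.
  by field; rewrite gt_eqF.
apply: (@le_trans _ _ (\int[Pr]_w (D w)%:E)).
  apply: (le_trans (le_abse_integral _ measurableT _)).
    by apply: emeasurable_funB;
      [exact: (measurable_int Pr (iff f sf))|exact: (measurable_int Pr (iff g sg))].
  apply: ge0_le_integral => //.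
  - apply: measurableT_comp => //.
    by apply: emeasurable_funB;
      [exact: (measurable_int Pr (iff f sf))|exact: (measurable_int Pr (iff g sg))].
  - exact/measurable_EFinP.
  move=> w _; rewrite -EFinB abse_EFin lee_fin.
  rewrite (_ : (_ - _)%R = (f (X k w) * u (X 0%N w) + g (X 0%N w) * u (X k w))%R); last first.
    by rewrite /u; ring.
  apply: (le_trans (ler_normD _ _)).
  have Y1 := young (f (X k w)) (u (X 0%N w)).
  have Y2 := young (g (X 0%N w)) (u (X k w)).
  have G : (eta * g (X 0%N w) ^+ 2 <= eta * f (X 0%N w) ^+ 2)%R.
    rewrite ler_pM2l// -(real_normK (num_real (f _))) -(real_normK (num_real (g _))).
    by rewrite ler_pXn2r ?nnegrE.
  by rewrite /D; lra.
have nsq (h : E -> R) n (c : R) : (0 <= c)%R -> measurable_fun setT (fun w => h (X n w)) ->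
    nnmeas (fun w => c%:E * ((h (X n w)) ^+ 2)%:E).
  by move=> c0 mh; apply: nnmeasM; [exact: nnmeas_cst|exact: nnmeas_sqr].
have e0 := ltW eta0; have ei0 : (0 <= eta^-1)%R by rewrite invr_ge0.
rewrite (_ : integral _ _ _ = \int[Pr]_w ((2^-1)%:E *
  (eta%:E * (f (X 0%N w) ^+ 2)%:E + eta%:E * (f (X k w) ^+ 2)%:E +
   (eta^-1)%:E * (u (X 0%N w) ^+ 2)%:E + (eta^-1)%:E * (u (X k w) ^+ 2)%:E))); last first.
  by apply: eq_integral => w _; rewrite /D !(EFinM, EFinD).
have [n1 n2] := (nsq f 0%N _ e0 (mf 0%N), nsq f k _ e0 (mf k)).
have [n3 n4] := (nsq u 0%N _ ei0 (mu2 0%N), nsq u k _ ei0 (mu2 k)).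
have [n12 n123] := (nnmeasD n1 n2, nnmeasD (nnmeasD n1 n2) n3).
rewrite nnmeas_integralZ//; last exact: nnmeasD.
rewrite !nnmeas_integralD// !nnmeas_integralZ ?lee_fin//; try exact: nnmeas_sqr.
rewrite !stationary_sqr// -/a -/b -!EFinM lee_fin.
by lra.
Qed.

End stationary_covariance.

(** * Comparison of the two chains over several steps *)

Section comparison.
Context d (X : measurableType d) (R : realType).
Variables (pi : probability X R) (q : R.-pker X ~> X) (r : X * X -> R).
Hypothesis hr : mh_ratio pi q r.
Variable P : R.-pker X ~> X.
Hypothesis hP : is_marginal_kernel q r P.
Variables (W : set R) (Q : R.-pker X ~> R).
Hypotheses (mW : measurable W) (W_ge0 : forall w, W w -> (0 <= w)%R).
Hypothesis hQ : weight_kernel W Q.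
Variables (pit : probability (X * R)%type R)
  (Pt : R.-pker (X * R)%type ~> (X * R)%type).
Hypotheses (hpit : is_pseudo_target pi Q pit) (hPt : is_pseudo_kernel q r Q Pt).
Variables (d1 : measure_display) (O : measurableType d1) (Pr : probability O R)
  (Y : nat -> {mfun O >-> X}).
Hypothesis hY : markov_chain pi P Pr Y.
Variables (d2 : measure_display) (Ot : measurableType d2)
  (Prt : probability Ot R) (Z : nat -> {mfun Ot >-> (X * R)%type}).
Hypothesis hZ : markov_chain pit Pt Prt Z.

Let invP h (nh : nnmeas h) := marginal_invariant hr hP nh.
Let invPt h (nh : nnmeas h) := pseudo_invariant hr mW W_ge0 hQ hpit hPt nh.

Let nnmeas_fst (h : X -> \bar R) : nnmeas h -> nnmeas (fun z : X * R => h z.1).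
Proof. by apply: nnmeas_comp; exact: measurable_fst. Qed.

(** The weights have mean 1, so the first marginal of the pseudo-marginal target
    is pi. *)
Lemma pseudo_target_fst (h : X -> \bar R) : nnmeas h ->
  \int[pit]_z h z.1 = \int[pi]_x h x.
Proof.
move=> nh; rewrite (pseudo_target_integral mW W_ge0 hQ hpit (nnmeas_fst nh)).
apply: eq_integral => x _ /=.
transitivity (\int[Q x]_w (h x * (Num.max 0 w)%:E)).
  by apply: eq_integral => w _; rewrite muleC.
rewrite nnmeas_integralZ ?(nnmeas_ge0 _ nh)//.
  by rewrite (integral_weight_pos mW W_ge0 hQ) mule1.
apply: nnmeas_EFin => [w|]; first by rewrite le_max lexx.
by apply: measurable_maxr => //; exact: measurable_cst.
Qed.

Lemma pseudo_target_expectation (g : X -> R) : measurable_fun setT g ->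
  \int[pit]_z (g z.1)%:E = \int[pi]_x (g x)%:E.
Proof.
move=> mg; have mEg : measurable_fun setT (EFin \o g) by exact/measurable_EFinP.
have np : nnmeas (EFin \o g)^\+ by split=> //; exact: measurable_funepos.
have nm : nnmeas (EFin \o g)^\- by split=> //; exact: measurable_funeneg.
rewrite integralE [RHS]integralE; congr (_ - _).
  rewrite -[RHS](pseudo_target_fst np).
  by apply: eq_integral => z _; rewrite !funeposE.
rewrite -[RHS](pseudo_target_fst nm).
by apply: eq_integral => z _; rewrite !funenegE.
Qed.

(** Induction on the number n of steps, for all h at once: the last step of the
    pseudo-marginal chain is replaced by a step of the marginal kernel P, with
    an error at most 2 C acc_error, whose mean under the stationary law is at
    most 6 C kappa; the remaining n steps are compared with P h in place of h,
    which obeys the same bounds. *)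
Lemma chain_comparison (phi : X -> R) (Cphi C : R) n (h : X -> \bar R) :
  (forall x, 0 <= phi x)%R -> (forall x, phi x <= Cphi)%R ->
  measurable_fun setT phi -> nnmeas h -> (forall x, h x <= C%:E) ->
  let bound := (n%:R * (6 * Cphi * C))%:E * \int[pi]_x weight_error Q x in
  (\int[Prt]_w ((phi (Z 0%N w).1)%:E * h (Z n w).1) <=
    \int[Pr]_w ((phi (Y 0%N w))%:E * h (Y n w)) + bound) /\
  (\int[Pr]_w ((phi (Y 0%N w))%:E * h (Y n w)) <=
    \int[Prt]_w ((phi (Z 0%N w).1)%:E * h (Z n w).1) + bound).
Proof.
move=> phi0 phiC mphi nh hC /=.
have nphi : nnmeas (fun x => (phi x)%:E) by exact: nnmeas_EFin.
have Cphi0 : (0 <= Cphi)%R by apply: le_trans (phiC point).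
have C0 : (0 <= C)%R by rewrite -lee_fin (le_trans _ (hC point))//; case: nh.
have mphi1 : measurable_fun setT (fun z : X * R => phi z.1).
  exact: (measurableT_comp mphi measurable_fst).
have nphi1 : nnmeas (fun z : X * R => (phi z.1)%:E) by exact: nnmeas_fst nphi.
set kappa := \int[pi]_x weight_error Q x.
have k0 : 0 <= kappa by apply: (pf_ge0 (pf_integral pi)); exact: nnmeas_weight_error.
elim: n h nh hC => [|n ih] h nh hC.
  have nph : nnmeas (fun x => (phi x)%:E * h x) by exact: nnmeasM.
  have EY := stationary_integral hY invP 0%N nph.
  have EZ := stationary_integral hZ invPt 0%N (nnmeas_fst nph).
  rewrite /= in EY EZ.
  by rewrite EY EZ (pseudo_target_fst nph) mul0r mul0e adde0; split.
have nh1 := nnmeas_fst nh.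
pose Th x := \int[P x]_y h y.
have nTh : nnmeas Th by exact: nnmeas_kernel_cst.
have ThC x : Th x <= C%:E by exact: integral_pker_le.
have nTtZ : nnmeas (fun z => \int[Pt z]_t h t.1).
  exact: (nnmeas_kernel_cst Pt nh1).
have nacc := nnmeas_acc_error hr Q.
have EY : \int[Pr]_w ((phi (Y 0%N w))%:E * h (Y n.+1 w)) =
    \int[Pr]_w ((phi (Y 0%N w))%:E * Th (Y n w)).
  exact: (markov_step hY (leq0n n) phi0 mphi nh).
have EZ : \int[Prt]_w ((phi (Z 0%N w).1)%:E * h (Z n.+1 w).1) =
    \int[Prt]_w ((phi (Z 0%N w).1)%:E * \int[Pt (Z n w)]_t h t.1).
  exact: (markov_step hZ (leq0n n) (fun z => phi0 z.1) mphi1 nh1).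
pose err w := (2 * C)%:E * acc_error q r Q (Z n w).
have nerr : nnmeas err.
  apply: (nnmeas_chain Z n (h := fun z => (2 * C)%:E * acc_error q r Q z)).
  by apply: nnmeasM => //; apply: nnmeas_cst; rewrite lee_fin mulr_ge0.
have nphiZ : nnmeas (fun w => (phi (Z 0%N w).1)%:E) by exact: (nnmeas_chain Z 0%N nphi1).
have nThZ : nnmeas (fun w => Th (Z n w).1).
  exact: (nnmeas_chain Z n (nnmeas_fst nTh)).
have nTtZw : nnmeas (fun w => \int[Pt (Z n w)]_t h t.1) by exact: (nnmeas_chain Z n nTtZ).
have errE : \int[Prt]_w ((phi (Z 0%N w).1)%:E * err w) <= (6 * Cphi * C)%:E * kappa.
  apply: (@le_trans _ _ (\int[Prt]_w (Cphi%:E * err w))).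
    apply: le_nnmeas_integral; [exact: nnmeasM| |].
      by apply: nnmeasM => //; apply: nnmeas_cst; rewrite lee_fin.
    move=> w; apply: lee_wpmul2r; first by case: nerr.
    by rewrite lee_fin.
  rewrite nnmeas_integralZ ?lee_fin// /err nnmeas_integralZ ?lee_fin ?mulr_ge0//; last first.
    exact: (nnmeas_chain Z n nacc).
  rewrite (stationary_integral hZ invPt n nacc) muleA -EFinM.
  rewrite (_ : 6 * Cphi * C = Cphi * (2 * C) * 3)%R; last by ring.
  rewrite [in leRHS]EFinM -muleA; apply: lee_wpmul2l.
    by rewrite lee_fin !mulr_ge0.
  exact: (acc_error_integral hr mW W_ge0 hQ hpit).
have [ihZ ihY] := ih Th nTh ThC.
have boundS : (n.+1%:R * (6 * Cphi * C))%:E * kappa =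
    (n%:R * (6 * Cphi * C))%:E * kappa + (6 * Cphi * C)%:E * kappa.
  rewrite -ge0_muleDl ?lee_fin ?mulr_ge0// -EFinD -natr1.
  by rewrite mulrDl mul1r.
rewrite EY EZ boundS; split.
- rewrite addeA; apply: (le_trans _ (leeD ihZ errE)).
  rewrite -nnmeas_integralD; [|exact: nnmeasM..].
  apply: le_nnmeas_integral; first exact: nnmeasM.
    by apply: nnmeasD; exact: nnmeasM.
  move=> w; rewrite -ge0_muleDr; [|by case: nThZ|by case: nerr].
  apply: lee_wpmul2l; first by case: nphiZ.
  rewrite /err; case: (Z n w) => x v.
  exact: (pseudo_marginal_perturb hr mW W_ge0 hQ x v hP hPt nh hC).1.
- rewrite addeCA; apply: (le_trans ihY); rewrite [leLHS]addeC leeD2l//.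
  apply: (le_trans _ (leeD2l _ errE)).
  rewrite -nnmeas_integralD; [|exact: nnmeasM..].
  apply: le_nnmeas_integral; first exact: nnmeasM.
    by apply: nnmeasD; exact: nnmeasM.
  move=> w; rewrite -ge0_muleDr; [|by case: nTtZw|by case: nerr].
  apply: lee_wpmul2l; first by case: nphiZ.
  rewrite /err; case: (Z n w) => x v.
  exact: (pseudo_marginal_perturb hr mW W_ge0 hQ x v hP hPt nh hC).2.
Qed.

Lemma weight_error_fin : \int[pi]_x weight_error Q x \is a fin_num.
Proof.
rewrite ge0_fin_numE; last first.
  by apply: (pf_ge0 (pf_integral pi)); exact: nnmeas_weight_error.
apply: (@le_lt_trans _ _ 2%:E); last exact: ltry.
apply: integral_prob_le; first exact: nnmeas_weight_error.
exact: (weight_error_le2 mW W_ge0 hQ).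
Qed.

Lemma square_integrable_bounded d' (E : measurableType d') (mu : probability E R)
    (f : E -> R) (M : R) : measurable_fun setT f -> (forall x, `|f x| <= M)%R ->
  square_integrable mu f.
Proof.
move=> mf fM; split=> //; apply: (@le_lt_trans _ _ ((M ^+ 2)%:E)); last exact: ltry.
apply: integral_prob_le; first exact: nnmeas_sqr.
move=> x; rewrite lee_fin -(real_normK (num_real (f x))) ler_pXn2r// nnegrE//.
exact: le_trans (fM x).
Qed.

Lemma square_integrable_fst (f : X -> R) : square_integrable pi f ->
  square_integrable pit (fun z : X * R => f z.1).
Proof.
move=> [mf f2]; split; first exact: (measurableT_comp mf measurable_fst).
by rewrite (pseudo_target_fst (nnmeas_sqr mf)).
Qed.

(** The function f + M takes values in [0, 2 M], so chain_comparison applies to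
    it; the constant shift changes the covariances of both chains by the same
    amount. *)
Lemma cov_comparison (f : X -> R) (M : R) k :
  measurable_fun setT f -> (forall x, `|f x| <= M)%R ->
  (`|cov Prt Z (fun z => f z.1) k - cov Pr Y f k| <=
    k%:R * (24 * M ^+ 2) * fine (\int[pi]_x weight_error Q x))%R.
Proof.
move=> mf fM; have M0 : (0 <= M)%R by exact: le_trans (fM point).
pose h x := (f x + M)%R.
have h0 x : (0 <= h x)%R by have := fM x; rewrite ler_norml /h => /andP[]; lra.
have hM x : (h x <= 2 * M)%R by have := fM x; rewrite ler_norml /h => /andP[]; lra.
have mh : measurable_fun setT h by apply: measurable_funD => //; exact: measurable_cst.
have nh : nnmeas (fun x => (h x)%:E) by exact: nnmeas_EFin.
have sh : square_integrable pi h.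
  by apply: (square_integrable_bounded _ mh) => x; rewrite ger0_norm.
have sh1 := square_integrable_fst sh.
have fE : f = (fun x => h x - M)%R by apply/funext => x; rewrite /h addrK.
have -> : cov Pr Y f k = (cov Pr Y h k - 2 * M * fine (\int[pi]_x (h x)%:E) + M ^+ 2)%R.
  by rewrite [in LHS]fE (cov_shift hY invP).
have -> : cov Prt Z (fun z => f z.1) k =
    (cov Prt Z (fun z => h z.1) k - 2 * M * fine (\int[pi]_x (h x)%:E) + M ^+ 2)%R.
  rewrite [in LHS]fE (cov_shift hZ invPt M k sh1).
  by rewrite (pseudo_target_fst nh).
rewrite (_ : (_ - _)%R = (cov Prt Z (fun z => h z.1) k - cov Pr Y h k)%R); last by ring.
have hC x : (h x)%:E <= (2 * M)%:E by rewrite lee_fin.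
have [] := chain_comparison k h0 hM mh nh hC.
rewrite -(fineK weight_error_fin).
have -> : \int[Prt]_w ((h (Z 0%N w).1)%:E * (h (Z k w).1)%:E) =
    (cov Prt Z (fun z => h z.1) k)%:E.
  by rewrite -(cov_integral hZ invPt 0%N k sh1); apply: eq_integral => w _.
have -> : \int[Pr]_w ((h (Y 0%N w))%:E * (h (Y k w))%:E) = (cov Pr Y h k)%:E.
  by rewrite -(cov_integral hY invP 0%N k sh); apply: eq_integral => w _.
rewrite -!EFinM -!EFinD !lee_fin => B1 B2.
rewrite (_ : 24 * M ^+ 2 = 6 * (2 * M) * (2 * M))%R; last by ring.
by rewrite ler_norml; apply/andP; split; lra.
Qed.

End comparison.

(** * Truncation and dominated convergence *)

Section truncation.
Context d (X : measurableType d) (R : realType) (pi : probability X R).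

Definition truncate (f : X -> R) (M : nat) (x : X) : R :=
  Num.max (- M%:R)%R (Num.min M%:R (f x)).

Lemma measurable_truncate f M : measurable_fun setT f ->
  measurable_fun setT (truncate f M).
Proof.
move=> mf; apply: measurable_maxr; first exact: measurable_cst.
by apply: measurable_minr => //; exact: measurable_cst.
Qed.

Lemma truncate_cases f M x (t := truncate f M x) :
  [\/ t = f x /\ (`|f x| <= M%:R)%R, t = M%:R /\ (M%:R <= f x)%R |
      t = (- M%:R)%R /\ (f x <= - M%:R)%R].
Proof.
have M0 : (0 <= M%:R :> R)%R by [].
rewrite /t /truncate; have [fM|/ltW fM] := leP (f x) M%:R.
  have [fM'|/ltW fM'] := leP (- M%:R)%R (f x); last by constructor 3.
  by constructor 1; rewrite ler_norml fM fM'.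
by constructor 2; rewrite (max_idPr _)//; lra.
Qed.

Lemma truncate_id f M x : (`|f x| <= M%:R)%R -> truncate f M x = f x.
Proof.
rewrite ler_norml => /andP[? ?].
by case: (truncate_cases f M x) => -[-> ?]//; lra.
Qed.

Lemma truncate_bounded f M x : (`|truncate f M x| <= M%:R)%R.
Proof.
have M0 : (0 <= M%:R :> R)%R by [].
by case: (truncate_cases f M x) => -[-> ?]//; rewrite ?normrN ger0_norm.
Qed.

Lemma truncate_le f M x : (`|truncate f M x| <= `|f x|)%R.
Proof.
have M0 : (0 <= M%:R :> R)%R by [].
have := ler_norm (f x); have := ler_norm (- f x)%R; rewrite normrN => ? ?.
by case: (truncate_cases f M x) => -[-> ?]//; rewrite ?normrN ger0_norm//; lra.
Qed.

Lemma truncate_dist_le f M x : (`|f x - truncate f M x| <= `|f x|)%R.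
Proof.
have M0 : (0 <= M%:R :> R)%R by [].
have := ler_norm (f x); have := ler_norm (- f x)%R; rewrite normrN => ? ?.
by rewrite ler_norml; case: (truncate_cases f M x) => -[-> ?]; apply/andP; split; lra.
Qed.

Lemma truncate_cvg f : square_integrable pi f ->
  (fun M => \int[pi]_x ((f x - truncate f M x) ^+ 2)%:E) @ \oo --> 0.
Proof.
move=> [mf f2].
have mft M : measurable_fun setT (fun x => f x - truncate f M x)%R.
  by apply: measurable_funB => //; exact: measurable_truncate.
have [] := @dominated_convergence _ X R pi setT measurableT
  (fun M x => ((f x - truncate f M x) ^+ 2)%:E) (cst 0) (fun x => ((f x) ^+ 2)%:E).
- by move=> M; apply/measurable_EFinP; exact: measurable_funX.
- exact: measurable_cst.
- apply: aeW => x _; apply: cvg_near_cst.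
  exists (Num.truncn `|f x|).+1 => // M /= xM.
  rewrite truncate_id ?subrr ?expr0n//.
  by rewrite (le_trans (ltW (truncnS_gt _)))// ler_nat.
- apply/integrableP; split; first by apply/measurable_EFinP; exact: measurable_funX.
  rewrite (_ : integral _ _ _ = \int[pi]_x ((f x) ^+ 2)%:E)//.
  by apply: eq_integral => x _; rewrite abse_EFin ger0_norm// sqr_ge0.
- apply: aeW => x M _; rewrite abse_EFin lee_fin ger0_norm ?sqr_ge0//.
  rewrite -(real_normK (num_real (f x))) -(real_normK (num_real (_ - _)%R)).
  by rewrite ler_pXn2r ?nnegrE//; exact: truncate_dist_le.
- by move=> _ _; rewrite integral0.
Qed.

End truncation.

Lemma weight_error_cvg d (X : measurableType d) (R : realType)
    (pi : probability X R) (W : set R) (Q : nat -> R.-pker X ~> R) :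
  measurable W -> (forall w, W w -> (0 <= w)%R) ->
  (forall N, weight_kernel W (Q N)) ->
  (forall x, (fun N => weight_error (Q N) x) @ \oo --> 0) ->
  (fun N => \int[pi]_x weight_error (Q N) x) @ \oo --> 0.
Proof.
move=> mW W_ge0 hQ Q0.
have [] := @dominated_convergence _ X R pi setT measurableT
  (fun N x => weight_error (Q N) x) (cst 0) (cst 2%:E).
- by move=> N; exact: (nnmeas_measurable (nnmeas_weight_error (Q N))).
- exact: measurable_cst.
- by apply: aeW => x _; exact: Q0.
- exact: finite_measure_integrable_cst.
- apply: aeW => x N _; rewrite gee0_abs; last by case: (nnmeas_weight_error (Q N)).
  exact: (weight_error_le2 mW W_ge0 (hQ N)).
- by move=> _ _; rewrite integral0.
Qed.

(** * Convergence of the asymptotic variances *)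

Lemma cvg_uniform_exchange (R : realType) (s : nat -> nat -> R) (u L : nat -> R)
    (l : R) (N0 : nat) :
  (forall n, (fun N => s N n) @ \oo --> u n) -> u @ \oo --> l ->
  (forall e, (0 < e)%R -> exists n0, forall n N, (n0 <= n)%N -> (N0 <= N)%N ->
    (`|L N - s N n| <= e)%R) ->
  L @ \oo --> l.
Proof.
move=> su ul unif; apply/cvgrPdist_le => e e0.
have e3 : (0 < e / 3)%R by rewrite divr_gt0.
have [n0 Hn0] := unif _ e3.
move/cvgrPdist_le : ul => /(_ _ e3)[n1 _ Hn1].
pose n := maxn n0 n1.
have := Hn1 n (leq_maxr _ _) => /= Hl.
move: (su n) => /cvgrPdist_le /(_ _ e3)[N1 _ HN1].
exists (maxn N0 N1) => // N /= NN.
have B1 := Hn0 n N (leq_maxl _ _) (leq_trans (leq_maxl _ _) NN).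
have /= B2 := HN1 N (leq_trans (leq_maxr _ _) NN).
rewrite (_ : l - L N = (l - u n) + (u n - s N n) - (L N - s N n))%R; last by ring.
apply: (le_trans (ler_normB _ _)); apply: (le_trans (lerD (ler_normD _ _) (lexx _))).
by lra.
Qed.

(** A bound on the tail of the series at rank n + 1 makes that tail finite, hence
    the whole series convergent, and it bounds the distance from s n to the
    limit. *)
Lemma cov_sum_tail (R : realType) (c : nat -> R) (n : nat) (e : R)
    (s := fun m => (c 0%N + 2 * \sum_(1 <= k < m.+1) c k)%R) :
  cvgn (fun m => \sum_(n.+1 <= k < m) (c k)%:E) ->
  `| \sum_(n.+1 <= k <oo) (c k)%:E | <= e%:E ->
  exists2 l : R, s @ \oo --> l & (`|l - s n| <= 2 * e)%R.
Proof.
move=> /[swap]; set T := limn _ => Te cT.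
have cT' : (fun m => \sum_(n.+1 <= k < m) (c k)%:E) @ \oo --> T by [].
have : T \is a fin_num by rewrite fin_num_abs (le_lt_trans Te)// ltry.
case: (T) Te cT' => [t||]// Te cT' _; move: Te; rewrite abse_EFin lee_fin => te.
have ct : (fun m => \sum_(n.+1 <= k < m) c k)%R @ \oo --> t.
  apply: (fine_cvg (f := fun m => (\sum_(n.+1 <= k < m) c k)%:E)).
  by under eq_fun do rewrite -sumEFin.
exists (s n + 2 * t)%R; last first.
  by rewrite addrAC subrr add0r normrM ger0_norm// ler_pM2l.
rewrite -(cvg_shiftn n).
have ct' : (fun m => \sum_(n.+1 <= k < (m + n).+1) c k)%R @ \oo --> t.
  by have := ct; rewrite -(cvg_shiftn n.+1); under eq_fun do rewrite addnS.
have : (fun m => s n + 2 * (\sum_(n.+1 <= k < (m + n).+1) c k))%R @ \oo --> (s n + 2 * t)%R.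
  by apply: cvgD; [exact: cvg_cst|apply: cvgM => //; exact: cvg_cst].
apply: cvg_trans; apply: near_eq_cvg; apply: nearW => m /=.
rewrite /s -addrA -mulrDr; congr (_ + 2 * _)%R.
by rewrite -big_cat_nat//= ltnS leq_addl.
Qed.

Lemma square_integrable_moment d (X : measurableType d) (R : realType)
    (pi : probability X R) (g : X -> R) (delta : R) : (0 < delta)%R ->
  measurable_fun setT g ->
  \int[pi]_x ((`|g x| `^ (2 + delta))%R)%:E < +oo -> square_integrable pi g.
Proof.
move=> d0 mg g2; split=> //.
have n1 : nnmeas (fun _ : X => 1 : \bar R) by exact: nnmeas_cst.
have n2 : nnmeas (fun x : X => (`|g x| `^ (2 + delta))%:E).
  apply: nnmeas_EFin => [x|]; first exact: powR_ge0.
  apply: (measurableT_comp (measurable_powR _)).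
  exact: (measurableT_comp (@normr_measurable R setT)).
apply: (@le_lt_trans _ _ (\int[pi]_x (1 + (`|g x| `^ (2 + delta))%:E))).
  apply: le_nnmeas_integral; [exact: nnmeas_sqr|exact: nnmeasD|move=> x].
  rewrite -EFinD lee_fin -(real_normK (num_real (g x))).
  have p0 := powR_ge0 (`|g x|)%R (2 + delta)%R.
  have [g1|g1] := leP (`|g x|)%R 1%R.
    by have := normr_ge0 (g x); nra.
  have d2 : (2 <= 2 + delta)%R by rewrite lerDl ltW.
  by have := ler_powR (ltW g1) d2; rewrite powR_mulrn//; lra.
rewrite nnmeas_integralD// integral_cst// mul1e; apply: lte_add_pinfty => //.
by rewrite (le_lt_trans (probability_le1 _ _))// ltry.
Qed.

Lemma square_integrable_center d (X : measurableType d) (R : realType)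
    (pi : probability X R) (g : X -> R) (c : R) :
  square_integrable pi g -> square_integrable pi (fun x => g x - c)%R.
Proof.
move=> [mg g2]; have mgc : measurable_fun setT (fun x => g x - c)%R.
  by apply: measurable_funB => //; exact: measurable_cst.
split=> //; apply: (@le_lt_trans _ _ (\int[pi]_x
    (2%:E * ((g x) ^+ 2)%:E + (2 * c ^+ 2)%:E))).
  have n2 := nnmeas_sqr mg.
  apply: le_nnmeas_integral; first exact: nnmeas_sqr.
    apply: nnmeasD; first by apply: nnmeasM => //; exact: nnmeas_cst.
    by apply: nnmeas_cst; rewrite lee_fin mulr_ge0// sqr_ge0.
  move=> x; rewrite -EFinM -EFinD lee_fin.
  by have := sqr_ge0 (g x + c)%R; nra.
have n2 := nnmeas_sqr mg.
rewrite nnmeas_integralD; last 2 first.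
- by apply: nnmeasM => //; exact: nnmeas_cst.
- by apply: nnmeas_cst; rewrite lee_fin mulr_ge0// sqr_ge0.
rewrite nnmeas_integralZ// integral_cst//; apply: lte_add_pinfty.
  by apply: lte_mul_pinfty.
by rewrite [X in _ * X]probability_setT mule1 ltry.
Qed.

Lemma expectationE d (T : measurableType d) (R : realType)
    (P : probability T R) (h : T -> R) : 'E_P[h] = \int[P]_w (h w)%:E.
Proof. by rewrite unlock. Qed.

Section asymptotic.
Context d d' (O : measurableType d) (E : measurableType d') (R : realType).
Variables (mu : probability E R) (K : R.-pker E ~> E) (Pr : probability O R)
  (X : nat -> {mfun O >-> E}).
Hypothesis hX : markov_chain mu K Pr X.
Hypothesis inv : forall h : E -> \bar R, nnmeas h ->
  \int[mu]_x \int[K x]_y h y = \int[mu]_x h x.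
Variable g : E -> R.
Hypothesis sg : square_integrable mu g.

Let c := fine 'E_mu[g].
Let f (x : E) : R := (g x - c)%R.
Let sf : square_integrable mu f. Proof. exact: square_integrable_center. Qed.

(** The Cesaro means of a convergent sequence have the same limit. *)
Lemma asymptotic_variance_series (l : R) :
  cov_sum Pr X f @ \oo --> l -> asymptotic_variance mu Pr X g = l%:E.
Proof.
move=> sl; apply: cvg_lim => //.
have := mean_square_sum_cvg hX inv sf sl.
by apply: cvg_trans; apply: near_eq_cvg; apply: nearW => n ; rewrite expectationE.
Qed.

(** When the variance vanishes, all covariances do, which settles the degenerate
    case of the autocorrelation time. *)
Lemma cov_le_var k : (`|cov Pr X f k| <= 2 * cov Pr X f 0)%R.
Proof.
have s0 : square_integrable mu (fun=> 0%R : R).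
  split; first exact: measurable_cst.
  by rewrite integral0_eq ?ltry// => x _; rewrite expr0n.
have f0 x : (`|0 : R| <= `|f x|)%R by rewrite normr0.
have := @cov_approx _ _ _ _ _ _ _ _ _ hX inv f (fun=> 0%R) 1%R k ltr01 sf s0 f0.
have -> : cov Pr X (fun=> 0%R) k = 0%R.
  by rewrite /cov integral0_eq// => w _; rewrite mul0r.
have -> : \int[mu]_x ((f x - 0) ^+ 2)%:E = \int[mu]_x ((f x) ^+ 2)%:E.
  by apply: eq_integral => x _; rewrite subr0.
by rewrite subr0 invr1 !mul1r (cov0E hX inv sf)/=; lra.
Qed.

Lemma iact_partialE n : iact_partial mu Pr X g n =
  (1 + 2 * \sum_(1 <= k < n.+1) (cov Pr X f k / cov Pr X f 0))%:E.
Proof.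
rewrite EFinD EFinM -sumEFin /iact_partial; congr (_ + _ * _).
apply: eq_bigr => k _.
have -> : fine 'V_mu[g] = cov Pr X f 0.
  rewrite -[RHS]/(fine (cov Pr X f 0)%:E) -(cov0E hX inv sf).
  by rewrite /variance unlock expectationE; congr fine; apply: eq_integral => x _; rewrite expr2.
have -> : cov Pr X f k = (cov Pr X g k - c ^+ 2)%R.
  rewrite (cov_shift hX inv c k sg) -/c.
  rewrite (_ : fine (\int[mu]_x (g x)%:E) = c); last by rewrite /c expectationE.
  by ring.
rewrite -/c [RHS]EFinM [in RHS]EFinB; congr ((_ - _) * _).
rewrite -(cov_integral hX inv 0%N k sg) expectationE.
by apply: eq_integral => w _; rewrite add0n.
Qed.

(** Up to the factor c_0, the partial sums defining the autocorrelation time are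
    those defining the asymptotic variance. *)
Lemma cov_sum_cvg_iact : iact_well_defined mu Pr X g ->
  iact mu Pr X g \is a fin_num -> exists l : R, cov_sum Pr X f @ \oo --> l.
Proof.
move=> wd fin; have [v0|v0] := eqVneq (cov Pr X f 0) 0%R.
  exists 0%R; rewrite (_ : cov_sum Pr X f = fun=> 0%R); first exact: cvg_cst.
  apply/funext => n; rewrite /cov_sum v0 add0r big1 ?mulr0// => k _.
  by have := cov_le_var k; rewrite v0 mulr0 normr_le0 => /eqP.
have : iact_partial mu Pr X g @ \oo --> iact mu Pr X g by exact: wd.
move: fin; case: (iact mu Pr X g) => [t||]// _ ct.
exists (cov Pr X f 0 * t)%R.
have ct' : (fun n => 1 + 2 * \sum_(1 <= k < n.+1) (cov Pr X f k / cov Pr X f 0))%R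
    @ \oo --> t.
  apply: (fine_cvg (f := fun n => (1 + 2 * \sum_(1 <= k < n.+1) (cov Pr X f k / cov Pr X f 0))%:E)).
  rewrite (_ : (fun n => _) = iact_partial mu Pr X g)//.
  by apply/funext => n; rewrite iact_partialE.
have : (fun n => cov Pr X f 0 * (1 + 2 *
    \sum_(1 <= k < n.+1) (cov Pr X f k / cov Pr X f 0)))%R @ \oo -->
    (cov Pr X f 0 * t)%R by apply: cvgM => //; exact: cvg_cst.
apply: cvg_trans; apply: near_eq_cvg; apply: nearW => n /=.
by rewrite /cov_sum -mulr_suml; field.
Qed.

End asymptotic.

Section pseudo_marginal_family.
Context d (X : measurableType d) (R : realType).
Variables (pi : probability X R) (q : R.-pker X ~> X) (r : X * X -> R).
Hypothesis hr : mh_ratio pi q r.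
Variable P : R.-pker X ~> X.
Hypothesis hP : is_marginal_kernel q r P.
Variables (W : set R) (Q : nat -> R.-pker X ~> R).
Hypotheses (mW : measurable W) (W_ge0 : forall w, W w -> (0 <= w)%R).
Hypothesis hQ : forall N, weight_kernel W (Q N).
Variables (pit : nat -> probability (X * R)%type R)
  (Pt : nat -> R.-pker (X * R)%type ~> (X * R)%type).
Hypotheses (hpit : forall N, is_pseudo_target pi (Q N) (pit N))
  (hPt : forall N, is_pseudo_kernel q r (Q N) (Pt N)).
Variables (d0 : measure_display) (O : measurableType d0) (Pr : probability O R)
  (Y : nat -> {mfun O >-> X}).
Hypothesis hY : markov_chain pi P Pr Y.
Variables (dt : nat -> measure_display) (Ot : forall N, measurableType (dt N))
  (Prt : forall N, probability (Ot N) R)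
  (Z : forall N, nat -> {mfun Ot N >-> (X * R)%type}).
Hypothesis hZ : forall N, markov_chain (pit N) (Pt N) (Prt N) (Z N).
Hypothesis error0 : forall x, (fun N => weight_error (Q N) x) @ \oo --> 0.

(** The truncation of f at level M costs at most e / 4 in the covariance of each
    chain, uniformly in N, for well chosen eta and M; the remaining difference
    of covariances of the truncation tends to 0 with the weight error. *)
Lemma pseudo_cov_cvg (f : X -> R) k : square_integrable pi f ->
  (fun N => cov (Prt N) (Z N) (fun z => f z.1) k) @ \oo --> cov Pr Y f k.
Proof.
move=> sf; apply/cvgrPdist_le => e e0.
have invP h (nh : nnmeas h) := marginal_invariant hr hP nh.
have invPt N h (nh : nnmeas h) :=
  pseudo_invariant hr mW W_ge0 (hQ N) (hpit N) (hPt N) nh.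
set a := fine (\int[pi]_x ((f x) ^+ 2)%:E).
have a0 : (0 <= a)%R by apply: fine_ge0; apply: integral_ge0 => x _; rewrite lee_fin sqr_ge0.
pose eta := (e / (8 * (a + 1)))%R.
have eta0 : (0 < eta)%R by rewrite divr_gt0// mulr_gt0// ltr_wpDl.
have etaa : (eta * a <= e / 8)%R.
  rewrite /eta mulrAC ler_pdivrMr ?mulr_gt0 ?ltr_wpDl//.
  by rewrite mulrA divfK//; nra.
have [M HM] : exists M, (eta^-1 * fine (\int[pi]_x
    ((f x - truncate f M x) ^+ 2)%:E) <= e / 8)%R.
  have /fine_cvgP[_ /cvgrPdist_le] := truncate_cvg sf.
  move=> /(_ (eta * (e / 8))%R) [|M _ /(_ M (leqnn M))/=].
    by rewrite mulr_gt0// divr_gt0.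
  rewrite sub0r normrN => H; exists M.
  by rewrite ler_pdivrMl//; exact: le_trans (ler_norm _) H.
have mT := measurable_truncate M sf.1.
have Tle := truncate_le f M.
have sT : square_integrable pi (truncate f M) := square_integrable_le mT Tle sf.
have /fine_cvgP[_ /cvgrPdist_le kappa0] :=
  weight_error_cvg pi mW W_ge0 hQ error0.
pose C := (k%:R * (24 * M%:R ^+ 2) : R)%R.
have C0 : (0 <= C)%R by rewrite !mulr_ge0// sqr_ge0.
have [|N1 _ HN1] := kappa0 (e / (4 * (C + 1)))%R.
  by rewrite divr_gt0// mulr_gt0// ltr_wpDl.
exists N1 => // N /= N1N.
have /= := HN1 N N1N; rewrite sub0r normrN => kappaN.
have D1 := cov_approx hY invP k eta0 sf sT Tle.
have D2 := cov_approx (hZ N) (invPt N) k eta0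
  (square_integrable_fst mW W_ge0 (hQ N) (hpit N) sf)
  (square_integrable_fst mW W_ge0 (hQ N) (hpit N) sT) (fun z => Tle z.1).
have D3 := cov_comparison hr hP mW W_ge0 (hQ N) (hpit N) (hPt N) hY (hZ N) k mT
  (truncate_bounded f M).
have mu : measurable_fun setT (fun x => f x - truncate f M x)%R.
  by apply: measurable_funB => //; case: sf.
rewrite (pseudo_target_fst mW W_ge0 (hQ N) (hpit N) (nnmeas_sqr sf.1)) in D2.
rewrite (pseudo_target_fst mW W_ge0 (hQ N) (hpit N) (nnmeas_sqr mu)) in D2.
rewrite -/a -/C in D1 D2 D3.
have D4 : (C * fine (\int[pi]_x weight_error (Q N) x) <= e / 4)%R.
  apply: (@le_trans _ _ (C * (e / (4 * (C + 1))))%R).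
    by apply: ler_wpM2l => //; exact: le_trans (ler_norm _) kappaN.
  rewrite mulrA ler_pdivrMr ?mulr_gt0 ?ltr_wpDl//.
  by rewrite mulrA divfK//; nra.
set cZ := cov (Prt N) (Z N) (fun z => f z.1) k in D2 *.
set cY := cov Pr Y f k in D1 *.
move: D1 D2 D3; rewrite !ler_norml => /andP[? ?] /andP[? ?] /andP[? ?].
by apply/andP; split; lra.
Qed.

Lemma pseudo_cov_sum_cvg (f : X -> R) n : square_integrable pi f ->
  (fun N => cov_sum (Prt N) (Z N) (fun z => f z.1) n) @ \oo --> cov_sum Pr Y f n.
Proof.
move=> sf; rewrite /cov_sum; apply: cvgD; first exact: pseudo_cov_cvg.
apply: cvgM; first exact: cvg_cst.
elim: (index_iota _ _) => [|k ks ih].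
  by rewrite big_nil; under eq_fun do rewrite big_nil; exact: cvg_cst.
rewrite big_cons; under eq_fun do rewrite big_cons.
by apply: cvgD => //; exact: pseudo_cov_cvg.
Qed.

End pseudo_marginal_family.

Theorem theorem21 (R : realType) (d : measure_display) (X : measurableType d)
  (pi : probability X R) (q : R.-pker X ~> X)
  (r : X * X -> R) (hr : mh_ratio pi q r)
  (P : R.-pker X ~> X) (hP : is_marginal_kernel q r P)
  (W : set R) (mW : measurable W) (W_ge0 : forall w : R, W w -> (0 <= w)%R)
  (Q : nat -> R.-pker X ~> R) (hQ : forall N, weight_kernel W (Q N))
  (pit : nat -> probability (X * R)%type R)
  (hpit : forall N, is_pseudo_target pi (Q N) (pit N))
  (Pt : nat -> R.-pker (X * R)%type ~> (X * R)%type)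
  (hPt : forall N, is_pseudo_kernel q r (Q N) (Pt N))
  (d0 : measure_display) (O : measurableType d0) (Pr : probability O R)
  (Y : nat -> {mfun O >-> X}) (hY : markov_chain pi P Pr Y)
  (dt : nat -> measure_display) (Ot : forall N, measurableType (dt N))
  (Prt : forall N, probability (Ot N) R)
  (Z : forall N, nat -> {mfun Ot N >-> (X * R)%type})
  (hZ : forall N, markov_chain (pit N) (Pt N) (Prt N) (Z N))
  (g : X -> R) (mg : measurable_fun setT g)
  (delta : R) (delta_gt0 : (0 < delta)%R)
  (hg : \int[pi]_x ((`|g x| `^ (2 + delta))%R)%:E < +oo) :
  let gbar : X -> R := fun x => (g x - fine 'E_pi[g])%R in
  let acov (N k : nat) : \bar R :=
    'E_(Prt N)[(fun w => gbar (Z N 0%N w).1 * gbar (Z N k w).1)%R] in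
  (iact_well_defined pi Pr Y g /\ iact pi Pr Y g \is a fin_num) ->
  (exists N0 : nat,
     (forall N n : nat, (N0 <= N)%N ->
        cvgn (fun m : nat => \sum_(n <= k < m) acov N k)) /\
     (fun n : nat =>
        ereal_sup [set `| \sum_(n <= k <oo) acov N k | | N in
                     [set N : nat | (N0 <= N)%N] ]) @ \oo --> 0) ->
  (forall x : X, (fun N : nat => \int[Q N x]_w (`|1 - w|%R)%:E) @ \oo --> 0) ->
  (fun N : nat =>
     asymptotic_variance (pit N) (Prt N) (Z N) (fun z : X * R => g z.1))
    @ \oo --> asymptotic_variance pi Pr Y g.
Proof.
move=> gbar acov [wd fin] [N0 [tail_cvg tail_sup]] error0.
have sg := square_integrable_moment delta_gt0 mg hg.
have sgbar : square_integrable pi gbar by exact: square_integrable_center.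
have invP h (nh : nnmeas h) := marginal_invariant hr hP nh.
have invPt N h (nh : nnmeas h) :=
  pseudo_invariant hr mW W_ge0 (hQ N) (hpit N) (hPt N) nh.
have sg1 N := square_integrable_fst mW W_ge0 (hQ N) (hpit N) sg.
have sgbar1 N := square_integrable_fst mW W_ge0 (hQ N) (hpit N) sgbar.
have mean N : fine 'E_(pit N)[fun z : X * R => g z.1] = fine 'E_pi[g].
  by rewrite !expectationE (pseudo_target_expectation mW W_ge0 (hQ N) (hpit N) mg).
have gbarE N : (fun z : X * R => g z.1 - fine 'E_(pit N)[fun z : X * R => g z.1])%R =
    (fun z => gbar z.1) by rewrite mean.
have [l ml] := cov_sum_cvg_iact hY invP sg wd fin.
rewrite (asymptotic_variance_series hY invP sg ml).
have acovE N k : acov N k = (cov (Prt N) (Z N) (fun z => gbar z.1) k)%:E.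
  rewrite -(cov_integral (hZ N) (invPt N) 0%N k (sgbar1 N)) /acov expectationE.
  by apply: eq_integral => w _; rewrite add0n.
pose s n N := cov_sum (Prt N) (Z N) (fun z => gbar z.1) n.
(* The uniform smallness of the tails at rank n + 1 bounds the distance from the
   partial sum s n N to its limit by e, for all N >= N0 at once. *)
have unif e : (0 < e)%R -> exists n0, forall n N, (n0 <= n)%N -> (N0 <= N)%N ->
    exists2 L, s^~ N @ \oo --> L & (`|L - s n N| <= e)%R.
  move=> e0; have /fine_cvgP[[n1 _ fin1] /cvgrPdist_le] := tail_sup.
  move=> /(_ (e / 2)%R) [|n2 _ small]; first by rewrite divr_gt0.
  exists (maxn n1 n2) => n N nn NN.
  have n1n : (n1 <= n.+1)%N by rewrite (leq_trans _ (leqW nn))// leq_maxl.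
  have n2n : (n2 <= n.+1)%N by rewrite (leq_trans _ (leqW nn))// leq_maxr.
  have sup_le : ereal_sup [set `| \sum_(n.+1 <= k <oo) acov N k | | N in
      [set N : nat | (N0 <= N)%N] ] <= (e / 2)%:E.
    have := small _ n2n; have := fin1 _ n1n => /=.
    case: (ereal_sup _) => [t||]//= _; rewrite sub0r normrN lee_fin.
    exact: le_trans (ler_norm _).
  have tailE m : \sum_(n.+1 <= k < m) acov N k =
      \sum_(n.+1 <= k < m) (cov (Prt N) (Z N) (fun z => gbar z.1) k)%:E.
    by apply: eq_bigr => k _.
  have [| |L sL Ls] := @cov_sum_tail R
    (fun k => cov (Prt N) (Z N) (fun z => gbar z.1) k) n (e / 2)%R.
  - by have := tail_cvg N n.+1 NN; under eq_fun do rewrite tailE.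
  - apply: le_trans sup_le; apply: ereal_sup_ubound; exists N => //.
    by congr (`| limn _ |); apply/funext => m; rewrite tailE.
  by exists L => //; apply: (le_trans Ls); lra.
pose L N := fine (asymptotic_variance (pit N) (Prt N) (Z N) (fun z : X * R => g z.1)).
have LE N (l' : R) : s^~ N @ \oo --> l' ->
    asymptotic_variance (pit N) (Prt N) (Z N) (fun z : X * R => g z.1) = l'%:E.
  move=> sl; apply: (asymptotic_variance_series (hZ N) (invPt N) (sg1 N)).
  by rewrite gbarE.
have Lcvg : L @ \oo --> l.
  apply: (@cvg_uniform_exchange R (fun N n => s n N) (cov_sum Pr Y gbar) L l N0) => //.
    move=> n; apply: (pseudo_cov_sum_cvg hr hP mW W_ge0 hQ hpit hPt hY hZ error0).
    exact: sgbar.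
  move=> e /unif[n0 H]; exists n0 => n N nn NN.
  by have [l' sl' ?] := H n N nn NN; rewrite /L (LE N l' sl').
have : (EFin \o L) @ \oo --> l%:E by apply: cvg_EFin => //; exact: nearW.
apply: cvg_trans; apply: near_eq_cvg; exists N0 => // N /= NN.
have [n0 /(_ n0 N (leqnn _) NN)[l' sl' _]] := unif 1%R ltr01.
by rewrite /L (LE N l' sl').
Qed.
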